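(* Every non-trivial ordered abelian group $G$ is augmentable by infinites, i.e. there exists a non-trivial ordered abelian group $H$ such that $G\preceq H\oplus G$ (in the language of ordered abelian groups $\{0,+,-,<\}$).
   Context: $H\oplus G$ denotes the direct sum ordered lexicographically with $H$ the more significant component: $(h,g)>0$ iff $h>0$, or $h=0$ and $g>0$. $G$ is identified with the convex subgroup $\{0\}\oplus G$. An ordered abelian group $G$ is augmentable by infinites if there exists a non-trivial $H$ with $G\preceq H\oplus G$; such $H$ is called an infinite augment of $G$. *)

(* Defs.v *)
From HB Require Import structures.
From mathcomp Require Import all_boot all_order all_algebra.

Set Implicit Arguments.
Unset Strict Implicit.
Unset Printing Implicit Defensive.

Import Order.TTheory GRing.Theory.
Local Open Scope ring_scope.

(* A plain record rather than an HB structure: an HB join of a total order and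
   a Zmodule would have to sit below Num.RealDomain in the hierarchy. *)
Record orderedAbGroup : Type := OrderedAbGroup {
  oag_sort :> porderZmodType;
  oag_total : total (<=%R : rel oag_sort);
  oag_lerD2 : forall z x y : oag_sort, x <= y -> z + x <= z + y
}.

Definition nontrivial (G : zmodType) : Prop := exists x : G, x != 0.

(* Componentwise group law of pairs, with the lexicographic order in which the
   first component is the more significant one. *)
Definition lexsum_pair (H G : Type) : Type := (H * G)%type.

HB.instance Definition _ (H G : porderZmodType) :=
  Order.POrder.copy (lexsum_pair H G) (H *lexi[ring_display] G).
HB.instance Definition _ (H G : porderZmodType) :=
  GRing.Zmodule.copy (lexsum_pair H G) (H * G)%type.

Fact lexsum_total (H G : orderedAbGroup) :
  total (<=%R : rel (lexsum_pair H G)).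
Proof.
move=> [x1 x2] [y1 y2]; rewrite !Order.ProdLexiOrder.leEprodlexi /=.
have := oag_total x1 y1; have := oag_total x2 y2.
by case: (x1 <= y1); case: (y1 <= x1).
Qed.

Fact lexsum_lerD2 (H G : orderedAbGroup) (z x y : lexsum_pair H G) :
  x <= y -> z + x <= z + y.
Proof.
case: z x y => [z1 z2] [x1 x2] [y1 y2].
rewrite !Order.ProdLexiOrder.leEprodlexi /= => /andP[le1 /implyP le2].
apply/andP; split; first exact: oag_lerD2.
apply/implyP => le3; apply/oag_lerD2/le2.
by have := oag_lerD2 (- z1) le3; rewrite !addKr.
Qed.

Definition lexsum (H G : orderedAbGroup) : orderedAbGroup :=
  @OrderedAbGroup (lexsum_pair H G) (@lexsum_total H G) (@lexsum_lerD2 H G).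

Lemma lexsum_gt0 (H G : orderedAbGroup) (h : H) (g : G) :
  ((0 : lexsum H G) < (h, g)) = (0 < h) || (h == 0) && (0 < g).
Proof.
rewrite Order.ProdLexiOrder.ltEprodlexi /=.
rewrite [0 < h]lt_def eq_le andbC.
by case: (0 <= h); case: (h <= 0); case: (0 < g).
Qed.

Definition lexsum_inr (H G : orderedAbGroup) (g : G) : lexsum H G := (0, g).

(* First-order logic over the language {0, +, -, <} with equality, in which -
   is the unary opposite. Variables are de Bruijn indices: under a quantifier,
   OVar 0 is the bound variable and OVar n.+1 is the outer OVar n. *)

Inductive oag_term : Type :=
| OVar of nat
| OZero
| OAdd of oag_term & oag_term
| OOpp of oag_term.

Inductive oag_formula : Type :=
| OEq of oag_term & oag_term
| OLt of oag_term & oag_term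
| ONot of oag_formula
| OAnd of oag_formula & oag_formula
| OOr of oag_formula & oag_formula
| OImplies of oag_formula & oag_formula
| OExists of oag_formula
| OForall of oag_formula.

Definition scons (T : Type) (x : T) (v : nat -> T) (n : nat) : T :=
  if n is n'.+1 then v n' else x.

Fixpoint oag_eval (G : orderedAbGroup) (v : nat -> G) (t : oag_term) : G :=
  match t with
  | OVar n => v n
  | OZero => 0
  | OAdd t1 t2 => oag_eval v t1 + oag_eval v t2
  | OOpp t1 => - oag_eval v t1
  end.

Fixpoint oag_holds (G : orderedAbGroup) (v : nat -> G) (f : oag_formula) :
    Prop :=
  match f with
  | OEq t1 t2 => oag_eval v t1 = oag_eval v t2
  | OLt t1 t2 => oag_eval v t1 < oag_eval v t2
  | ONot f1 => ~ oag_holds v f1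
  | OAnd f1 f2 => oag_holds v f1 /\ oag_holds v f2
  | OOr f1 f2 => oag_holds v f1 \/ oag_holds v f2
  | OImplies f1 f2 => oag_holds v f1 -> oag_holds v f2
  | OExists f1 => exists x : G, oag_holds (scons x v) f1
  | OForall f1 => forall x : G, oag_holds (scons x v) f1
  end.

Definition elementary_embedding (G K : orderedAbGroup) (i : G -> K) : Prop :=
  forall (f : oag_formula) (v : nat -> G),
    oag_holds v f <-> oag_holds (i \o v) f.

(* The elementary extension of G by the lexicographic sum of H and G, where G
   is identified with the convex subgroup of the pairs (0, g). *)
Definition infinite_augment (G H : orderedAbGroup) : Prop :=
  nontrivial H /\ elementary_embedding (@lexsum_inr H G).

Definition augmentable_by_infinites (G : orderedAbGroup) : Prop :=
  exists H : orderedAbGroup, infinite_augment G H.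

(* Main.v *)
Require Import Defs.
From HB Require Import structures.
From mathcomp Require Import all_boot all_order all_algebra.
From mathcomp Require Import boolp classical_sets functions filter.
From mathcomp Require Import ring.

(* It suffices to find an end extension: some [A] elementarily extending [G]
   together with a proper convex subgroup [D] of [A] that also elementarily
   extends [G]. Indeed the complete type of a tuple of a convex subgroup [D] in
   [A] is determined by its type in [D] and the theory of [A / D], so with
   [H = A / D] the groups [H + G], [H + D] and [A] agree on tuples of [G].
   This transfer is a back-and-forth between sufficiently saturated extensions:
   a saturated convex subgroup is algebraically compact, so sections of the
   quotient map over finite stages can be prolonged.

   For the end extension, replace [G] by an ultrapower of an ultrapower: then
   [G] is the directed union, without largest element, of saturated convex
   subgroups [K]. In an ultrapower [A] of this [G] take for [D] the union of the
   ultrapowers [K*] of the [K]. Since [K] and [K*] have the same types and so do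
   the quotients of two such subgroups, tuples in [K] and [K*] with the same
   type form a back-and-forth system between [G] and [D]; and [D] is proper if
   the ultrafilter refines the order of the directed union. *)

Set Implicit Arguments.
Unset Strict Implicit.
Unset Printing Implicit Defensive.

Import Order.TTheory GRing.Theory Num.Theory.
Local Open Scope ring_scope.

(** * Linear identities in abelian groups *)

Inductive zexpr : Type :=
| ZVar of nat
| ZZero
| ZAdd of zexpr & zexpr
| ZOpp of zexpr
| ZMul of int & zexpr.

Fixpoint zeval (V : zmodType) (s : seq V) (e : zexpr) : V :=
  match e with
  | ZVar i => nth 0 s i
  | ZZero => 0
  | ZAdd e1 e2 => zeval s e1 + zeval s e2
  | ZOpp e1 => - zeval s e1
  | ZMul m e1 => zeval s e1 *~ m
  end.

(** The Kronecker delta, defined by recursion so that it computes on closed indices. *)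
Fixpoint zdelta (i j : nat) : int :=
  match i, j with
  | 0, 0 => 1
  | i'.+1, j'.+1 => zdelta i' j'
  | _, _ => 0
  end%N.

Lemma zdeltaE (i j : nat) : zdelta i j = (i == j)%:R.
Proof. by elim: i j => [|i IH] [|j] //=; rewrite IH eqSS. Qed.

Fixpoint zcoef (e : zexpr) (i : nat) : int :=
  match e with
  | ZVar j => zdelta i j
  | ZZero => 0
  | ZAdd e1 e2 => zcoef e1 i + zcoef e2 i
  | ZOpp e1 => - zcoef e1 i
  | ZMul m e1 => zcoef e1 i * m
  end.

(** A nested conjunction, so that a concrete [n] leaves finitely many goals for [ring] over the
    integers. *)
Fixpoint zcoef_eq (e1 e2 : zexpr) (n : nat) : Prop :=
  if n is n'.+1 then zcoef e1 n' = zcoef e2 n' /\ zcoef_eq e1 e2 n' else True.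

Lemma zevalE (V : zmodType) (s : seq V) (e : zexpr) :
  zeval s e = \sum_(i < size s) s`_i *~ zcoef e i.
Proof.
elim: e => [j||e1 IH1 e2 IH2|e IH|m e IH] /=.
- have [ltjs|lesj] := ltnP j (size s).
    rewrite (bigD1 (Ordinal ltjs)) //= zdeltaE eqxx mulr1z big1 ?addr0 // => i.
    by rewrite -val_eqE /= zdeltaE => /negPf ->.
  rewrite nth_default // big1 // => i _; rewrite zdeltaE.
  by case: eqP => // eij; have := ltn_ord i; rewrite eij ltnNge lesj.
- by rewrite big1.
- by rewrite IH1 IH2 -big_split; apply: eq_bigr => i _; rewrite mulrzDr.
- by rewrite IH -sumrN; apply: eq_bigr => i _; rewrite mulrNz.
- by rewrite IH mulrz_suml; apply: eq_bigr => i _; rewrite mulrzA.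
Qed.

Lemma zeval_eq (V : zmodType) (s : seq V) (e1 e2 : zexpr) :
  zcoef_eq e1 e2 (size s) -> zeval s e1 = zeval s e2.
Proof.
rewrite !zevalE => eq12; apply: eq_bigr => i _; congr (_ *~ _).
elim: (size s) (i : nat) (ltn_ord i) eq12 => // n IH j ltjn /= [eqn eqs].
by move: ltjn; rewrite ltnS leq_eqVlt => /predU1P[->//|/IH]; apply.
Qed.

Ltac zmem x s :=
  lazymatch s with
  | nil => constr:(false)
  | cons x _ => constr:(true)
  | cons _ ?s' => zmem x s'
  end.

Ltac zindex x s :=
  lazymatch s with
  | cons x _ => constr:(0%N)
  | cons _ ?s' => let i := zindex x s' in constr:(S i)
  end.

Ltac zatoms s e :=
  lazymatch e with
  | GRing.add ?a ?b => let s' := zatoms s a in zatoms s' b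
  | GRing.opp ?a => zatoms s a
  | GRing.natmul ?a _ => zatoms s a
  | intmul ?a _ => zatoms s a
  | GRing.zero => s
  | _ => let b := zmem e s in
         lazymatch b with true => s | false => constr:(cons e s) end
  end.

Ltac zreify s e :=
  lazymatch e with
  | GRing.add ?a ?b =>
      let a' := zreify s a in let b' := zreify s b in constr:(ZAdd a' b')
  | GRing.opp ?a => let a' := zreify s a in constr:(ZOpp a')
  | GRing.natmul ?a ?n => let a' := zreify s a in constr:(ZMul (Posz n) a')
  | intmul ?a ?n => let a' := zreify s a in constr:(ZMul n a')
  | GRing.zero => constr:(ZZero)
  | _ => let i := zindex e s in constr:(ZVar i)
  end.

(* Decides linear identities of abelian groups by comparing the integer
   coefficients, which may themselves be symbolic. *)
Ltac zlin :=
  lazymatch goal with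
  | |- @eq ?T ?x ?y =>
      let s := zatoms (@nil T) x in
      let s := zatoms s y in
      let e1 := zreify s x in
      let e2 := zreify s y in
      apply: (@zeval_eq _ s e1 e2); cbn [zcoef zcoef_eq zdelta size];
      repeat (split; [ring|]); exact I
  end.

(** * Prolonging sections of abelian groups *)

(** The gcd is returned as [g.+1], the shape of the multiplier in [pure], so that purity can cancel
    it. *)
Lemma Bezout_cofactors (a b : int) : b != 0 ->
  exists (b' a' : int) (g : nat), [/\ b = b' * g.+1%:Z, a = a' * g.+1%:Z &
    exists u v : int, u * b' + v * a' = 1].
Proof.
move=> b0; have [u [v uvE]] := Bezoutz b a.
have g0 : gcdz b a != 0 by rewrite gcdz_eq0 (negPf b0).
have gE : gcdz b a = (`|gcdz b a|.-1).+1%:Z.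
  by rewrite prednK ?absz_gt0 // abszE ger0_norm ?gcdz_ge0.
exists (b %/ gcdz b a)%Z, (a %/ gcdz b a)%Z, (`|gcdz b a|.-1); rewrite -gE.
split; rewrite ?divzK ?dvdz_gcdl ?dvdz_gcdr //.
exists u, v; apply: (mulIf g0).
by rewrite mulrDl -!mulrA !divzK ?dvdz_gcdl ?dvdz_gcdr // mul1r.
Qed.

Definition subgroup (V : zmodType) (P : V -> Prop) : Prop :=
  P 0 /\ forall x y, P x -> P y -> P (x - y).

Section Subgroup.

Variables (V : zmodType) (P : V -> Prop).
Hypothesis sgP : subgroup P.

Lemma subgroup0 : P 0. Proof. exact: sgP.1. Qed.

Lemma subgroupB x y : P x -> P y -> P (x - y). Proof. exact: sgP.2. Qed.

Lemma subgroupN x : P x -> P (- x).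
Proof.
by move=> Px; rewrite -sub0r; apply: subgroupB => //; apply: subgroup0.
Qed.

Lemma subgroupD x y : P x -> P y -> P (x + y).
Proof. by move=> Px Py; rewrite -[y]opprK; apply/subgroupB/subgroupN. Qed.

Lemma subgroupMn x n : P x -> P (x *+ n).
Proof.
move=> Px; elim: n => [|n IH]; first exact: subgroup0.
by rewrite mulrS; apply: subgroupD.
Qed.

Lemma subgroupMz x m : P x -> P (x *~ m).
Proof.
case: m => n Px; first exact: subgroupMn.
by rewrite NegzE mulrNz; apply/subgroupN/subgroupMn.
Qed.

End Subgroup.

Ltac subg := by repeat first [assumption | apply: subgroup0
  | apply: subgroupB | apply: subgroupD | apply: subgroupN
  | apply: subgroupMn | apply: subgroupMz].

(* The system of congruences [x m_j = c_j mod k_j] is required to hold modulo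
   [N] only; infinite systems of this form are what algebraic compactness of
   [K / N] is about. *)
Definition solution (V : zmodType) (K N : V -> Prop) (m : int) (k : nat)
    (c e : V) : Prop :=
  exists2 z, K z & N (e *~ m - c - z *+ k).

Definition algebraically_compact (V : zmodType) (K N : V -> Prop) : Prop :=
  forall (m : nat -> int) (k : nat -> nat) (c : nat -> V),
    (forall j, K (c j)) ->
    (forall n, exists2 e, K e &
       forall j, (j < n)%N -> solution K N (m j) (k j) (c j) e) ->
  exists2 e, K e & forall j, solution K N (m j) (k j) (c j) e.

(** For subgroups [K] of [A] this means that [A / K] is torsion-free. *)
Definition pure (V : zmodType) (A K : V -> Prop) : Prop :=
  forall x k, A x -> K (x *+ k.+1) -> K x.

(* [P] is the image of a partial section of [A / N -> A / K] that can be
   extended to the pure closure of its domain. *)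
Definition pure_section (V : zmodType) (A K N P : V -> Prop) : Prop :=
  forall u k y, P u -> A y -> K (u - y *+ k) ->
    exists2 y', A y' & N (u - y' *+ k).

Section SectionExtension.

Variables (V : zmodType) (A K N P : V -> Prop).
Hypotheses (sgA : subgroup A) (sgK : subgroup K) (sgN : subgroup N).
Hypotheses (sgP : subgroup P).
Hypotheses (NK : forall x, N x -> K x) (KA : forall x, K x -> A x).
Hypotheses (PA : forall x, P x -> A x).
Hypotheses (pureK : pure A K) (pureN : pure A N).
Hypothesis secP : pure_section A K N P.

(** The pure closure of [P + N] in [A]. *)
Let hull (u : V) := A u /\ exists k, exists2 p, P p & N (u *+ k.+1 - p).

Let sg_hull : subgroup hull.
Proof.
split; first by split; [exact: subgroup0|exists 0%N, 0; rewrite ?subrr; subg].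
move=> u v [Au [k [p Pp Np]]] [Av [l [q Pq Nq]]]; split; first subg.
exists (k.+1 * l.+1).-1%N, (p *+ l.+1 - q *+ k.+1); first subg.
rewrite prednK //.
have -> : (u - v) *+ (k.+1 * l.+1)%N - (p *+ l.+1 - q *+ k.+1) =
  (u *+ k.+1 - p) *+ l.+1 - (v *+ l.+1 - q) *+ k.+1 by zlin.
subg.
Qed.

Let hullP u : P u -> hull u.
Proof.
by move=> Pu; split; [exact: PA|exists 0%N, u; rewrite ?subrr //; subg].
Qed.

(** The section property passes from [P] to its hull: clear the denominator [l.+1], divide by
    [k * l.+1], and cancel [l.+1] by purity of [N]. *)
Let hull_split u k y :
  hull u -> A y -> K (u - y *+ k) -> exists2 y', A y' & N (u - y' *+ k).
Proof.
move=> [Au [l [p Pp Np]]] Ay Ku.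
have [|y' Ay' Ny'] := secP (k := (k * l.+1)%N) Pp Ay.
  have -> : p - y *+ (k * l.+1) =
    (u - y *+ k) *+ l.+1 - (u *+ l.+1 - p) by zlin.
  by have := NK Np => ?; subg.
exists y' => //; apply: (@pureN _ l); first subg.
have -> : (u - y' *+ k) *+ l.+1 = (u *+ l.+1 - p) + (p - y' *+ (k * l.+1)).
  by zlin.
subg.
Qed.

(** Division by [k = 0] shows that [hull / N] embeds into [A / K]. *)
Let hullK u : hull u -> K u -> N u.
Proof.
move=> hu Ku.
have [|y' _] := hull_split (k := 0%N) hu (subgroup0 sgA).
  by rewrite mulr0n subr0.
by rewrite mulr0n subr0.
Qed.

Let hull_root u k y : hull u -> A y -> N (u - y *+ k.+1) -> hull y.
Proof.
move=> [Au [l [p Pp Np]]] Ay Ny; split=> //.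
exists (k.+1 * l.+1).-1%N, p => //; rewrite prednK //.
have -> : y *+ (k.+1 * l.+1)%N - p =
  (u *+ l.+1 - p) - (u - y *+ k.+1) *+ l.+1 by zlin.
subg.
Qed.

(** Membership of [y] in the cyclic subgroup generated by [z] in the torsion-free group
    [A / (K + hull)]. *)
Let span (z y : V) := exists l u, hull u /\ K (y - z *~ l - u).

Let sg_span z : subgroup (span z).
Proof.
split; first by exists 0, 0; rewrite mulr0z !subr0; split; exact: subgroup0.
move=> x y [l [u [hu Ku]]] [l' [u' [hu' Ku']]].
exists (l - l'), (u - u'); split; first subg.
have -> : x - y - z *~ (l - l') - (u - u') =
  (x - z *~ l - u) - (y - z *~ l' - u') by zlin.
subg.
Qed.

Let span_id z : span z z.
Proof. by exists 1, 0; rewrite mulr1z subrr subr0; split; exact: subgroup0. Qed.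

Let span_trans z z' y : span z' z -> span z y -> span z' y.
Proof.
move=> [l [u [hu Ku]]] [l' [u' [hu' Ku']]].
exists (l * l'), (u *~ l' + u'); split; first subg.
have -> : y - z' *~ (l * l') - (u *~ l' + u') =
  (z - z' *~ l - u) *~ l' + (y - z *~ l' - u') by zlin.
subg.
Qed.

Let hull_span z u : hull u -> span z u.
Proof.
by exists 0, u; rewrite mulr0z subr0 subrr; split=> //; exact: subgroup0.
Qed.

(* A finitely generated torsion-free group of rank one is cyclic. *)
Let span_step z y (k : nat) :
  A z -> A y -> span z (y *+ k.+1) -> exists2 z', A z' & span z' z /\ span z' y.
Proof.
move=> Az Ay [a [u [hu Ku]]].
have [k' [a' [g [kE aE [al [be bez]]]]]] :=
  Bezout_cofactors a (isT : k.+1%:Z != 0).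
(* [w *+ g.+1] is congruent to [u] modulo [K]. Dividing [u] by [g.+1] inside [hull] gives [y0],
   which is congruent to [w] by purity of [K]. *)
pose w := y *~ k' - z *~ a'.
have Aw : A w by rewrite /w; subg.
have KgE : y *+ k.+1 - z *~ a - u = w *+ g.+1 - u.
  by rewrite /w pmulrn kE aE; zlin.
have [y0 Ay0 Ny0] : exists2 y', A y' & N (u - y' *+ g.+1).
  apply: (hull_split (y := w)) => //.
  have -> : u - w *+ g.+1 = - (w *+ g.+1 - u) by zlin.
  by rewrite -KgE; subg.
have hy0 := hull_root hu Ay0 Ny0.
have Kwy : K (w - y0).
  apply: (@pureK _ g); first subg.
  have -> : (w - y0) *+ g.+1 = (w *+ g.+1 - u) + (u - y0 *+ g.+1) by zlin.
  by rewrite -KgE; have := NK Ny0 => ?; subg.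
(* Modulo [K + hull], [y *~ k'] equals [z *~ a'], so [k'] and [a'] times this Bezout combination are
   [z] and [y]. *)
exists (z *~ al + y *~ be); first subg.
split.
  exists k', (- (y0 *~ be)); split; first subg.
  have -> : z - (z *~ al + y *~ be) *~ k' - - (y0 *~ be) =
     z - z *~ (al * k' + be * a') - (w - y0) *~ be by rewrite /w; zlin.
  by rewrite bez mulr1z subrr; subg.
exists a', (y0 *~ al); split; first subg.
have -> : y - (z *~ al + y *~ be) *~ a' - y0 *~ al =
   y - y *~ (al * k' + be * a') + (w - y0) *~ al by rewrite /w; zlin.
by rewrite bez mulr1z subrr; subg.
Qed.

(** The element [e] is chosen so that [x - e] prolongs the section: every divisibility modulo [K]
    involving it must hold modulo [N]. Each one is a congruence on [e], and the enumeration [f]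
    makes them countably many, as algebraic compactness requires. *)
Lemma section_extension (x : V) (f : nat -> V * int * nat) :
  (forall u m k, P u -> exists j, f j = (u, m, k)) ->
  algebraically_compact K N -> A x ->
  exists2 e, K e & forall m u k y, P u -> A y ->
    K ((x - e) *~ m + u - y *+ k) ->
    exists2 y', A y' & N ((x - e) *~ m + u - y' *+ k).
Proof.
move=> f_surj compK Ax.
(* If a positive multiple of [x] lies in [hull + K], so does [x], and [e] is its component in
   [K]. *)
have [[a [u [hu Ku]]]|indep] :=
  pselect (exists a u, hull u /\ K (u - x *+ a.+1)).
  have [y Ay Ny] := hull_split hu Ax Ku.
  have hy := hull_root hu Ay Ny.
  exists (x - y).
    apply: (@pureK _ a); first subg.
    have -> : (x - y) *+ a.+1 = (u - y *+ a.+1) - (u - x *+ a.+1) by zlin.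
    by have := NK Ny => ?; subg.
  move=> m p k z Pp Az; rewrite subKr => Kz.
  by apply: (hull_split (y := z)) => //; have := hullP Pp => ?; subg.
(* Otherwise [x] is independent of [hull] modulo [K], so relations can be compared by their
   coefficient of [x]. *)
have indepz (m : int) u : hull u -> K (x *~ m + u) -> m = 0.
  move=> hu; case: m => [[|m]|m] // Ku; case: indep.
    exists m, (- u); split; first subg.
    have -> : - u - x *+ m.+1 = - (x *~ Posz m.+1 + u) by zlin.
    subg.
  exists m, u; split=> //.
  by have -> : u - x *+ m.+1 = x *~ Negz m + u by rewrite NegzE mulrNz addrC.
(* For an active index the element coded by [f j] is divisible modulo [K] by a positive integer;
   division by zero is left to independence. *)
pose good j y := A y /\ K (x *~ (f j).1.2 + (f j).1.1 - y *+ (f j).2).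
pose active j := [/\ (0 < (f j).2)%N, P (f j).1.1 & exists y, good j y].
have /choice[s sP] j : exists y, active j -> good j y.
  have [[_ _ [y gy]]|nact] := pselect (active j); first by exists y.
  by exists 0.
(* The congruence on [e] says that [s j], corrected by an element of [K], becomes a quotient modulo
   [N]. Inactive indices get a trivial congruence. *)
pose c j := if `[< active j >] then x *~ (f j).1.2 + (f j).1.1 - s j *+ (f j).2
            else 0.
pose m j := if `[< active j >] then (f j).1.2 else 0.
have [|n|e Ke eP] := compK m (fun j => (f j).2) c.
- move=> j; rewrite /c; case: asboolP => [/sP[]//|_]; exact: subgroup0.
(* For finitely many congruences, one [z] generates [x] and all the quotients [s j] modulo
   [K + hull]; the [K]-component of [x] relative to [z] is then a solution. *)
- have [z [Az zx zs]] : exists z, [/\ A z, span z x &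
      forall j, (j < n)%N -> active j -> span z (s j)].
    elim: n => [|n [z [Az zx zs]]]; first by exists x; split.
    have [act|nact] := pselect (active n); last first.
      exists z; split=> // j; rewrite ltnS leq_eqVlt.
      by case/predU1P => [->|/zs].
    have [k_gt0 Pu _] := act; have [As Ks] := sP _ act.
    have [|z' Az' [z'z z's]] := span_step (k := (f n).2.-1) Az As.
      rewrite prednK //.
      have -> : s n *+ (f n).2 = (x *~ (f n).1.2 + (f n).1.1) -
         (x *~ (f n).1.2 + (f n).1.1 - s n *+ (f n).2) by rewrite subKr.
      have spK y : K y -> span z y.
        by exists 0, 0; rewrite mulr0z !subr0; split=> //; exact: subgroup0.
      have spu := hull_span z (hullP Pu); have spK' := spK _ Ks.
      by have spz := sg_span z; subg.
    exists z'; split=> //; first exact: span_trans zx.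
    move=> j; rewrite ltnS leq_eqVlt => /predU1P[->//|ltjn act_j].
    by apply: span_trans (zs _ ltjn act_j).
  have [h [u [hu Ku]]] := zx.
  exists (x - z *~ h - u) => // j ltjn; rewrite /solution /m /c.
  case: asboolP => [act|_]; last first.
    exists 0; first exact: subgroup0.
    by rewrite mulr0z mul0rn !subr0; exact: subgroup0.
  have [k_gt0 Pu _] := act; have [As Ks] := sP _ act.
  have [l [v [hv Kv]]] := zs _ ltjn act.
  case: (f j) (s j) k_gt0 Pu As Ks Kv => [[p q] k] y /= k_gt0 Pp Ay Ky Kv.
  exists (y - z *~ l - v) => //.
  have hp := hullP Pp.
  (* Multiplying the relation by [h] turns the multiple of [z] into a multiple of [x], so that
     independence applies. *)
  have hq0 : h * q - l * k%:Z = 0.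
    have hwit : hull (u *~ (l * k%:Z - h * q) + (u *~ q + p - v *+ k) *~ h).
      subg.
    apply: (indepz _ _ hwit).
    have -> : x *~ (h * q - l * k%:Z) +
       (u *~ (l * k%:Z - h * q) + (u *~ q + p - v *+ k) *~ h) =
     (x - z *~ h - u) *~ (h * q - l * k%:Z) +
     ((x *~ q + p - y *+ k) - (x - z *~ h - u) *~ q +
      (y - z *~ l - v) *+ k) *~ h by zlin.
    subg.
  have Nw : N (u *~ q + p - v *+ k).
    apply: hullK; first subg.
    have -> : u *~ q + p - v *+ k =
      (x *~ q + p - y *+ k) - (x - z *~ h - u) *~ q + (y - z *~ l - v) *+ k
        - z *~ (h * q - l * k%:Z) by zlin.
    rewrite hq0 mulr0z subr0; subg.
  have -> : (x - z *~ h - u) *~ q - (x *~ q + p - y *+ k) -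
       (y - z *~ l - v) *+ k =
     - (z *~ (h * q - l * k%:Z)) - (u *~ q + p - v *+ k) by zlin.
  by rewrite hq0 mulr0z oppr0 add0r; subg.
exists e => // q p k y Pp Ay Ky.
have [k0|k_gt0] := posnP k.
  have hp := hullP Pp; move: Ky; rewrite k0 !mulr0n subr0 => Ky.
  have q0 : q = 0.
    apply: (indepz _ p) => //.
    have -> : x *~ q + p = ((x - e) *~ q + p) + e *~ q by zlin.
    subg.
  exists 0; first exact: subgroup0.
  by move: Ky; rewrite q0 !mulr0z !add0r; apply: hullK.
have [j fj] := f_surj p q k Pp.
have act : active j.
  rewrite /active fj; split=> //; exists y; rewrite /good fj; split=> //=.
  have -> : x *~ q + p - y *+ k = ((x - e) *~ q + p - y *+ k) + e *~ q by zlin.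
  subg.
have [z Kz Nz] := eP j; have [As Ks] := sP _ act.
have Az := KA Kz; exists (s j - z); first subg.
move: Nz; rewrite /m /c; case: asboolP => // _; rewrite fj /= => Nz.
have -> : (x - e) *~ q + p - (s j - z) *+ k =
  - (e *~ q - (x *~ q + p - s j *+ k) - z *+ k) by zlin.
subg.
Qed.

End SectionExtension.

(** * Preordered groups and their first-order types *)

(* A totally preordered group carried by a subgroup of [V]; it stands for the
   ordered group obtained by identifying the elements that are both nonnegative
   and nonpositive. Convex subgroups, quotients by convex subgroups and
   ultraproducts then need no new carrier types besides function types. *)
Record preordered (V : zmodType) : Type := Preordered {
  dom : V -> Prop;
  nng : V -> Prop;
  dom_subgroup : subgroup dom;
  nng_total : forall x, dom x -> nng x \/ nng (- x);
  nngD : forall x y, dom x -> dom y -> nng x -> nng y -> nng (x + y)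
}.

Definition null (V : zmodType) (A : preordered V) (x : V) : Prop :=
  [/\ dom A x, nng A x & nng A (- x)].

Section Preordered.

Variables (V : zmodType) (A : preordered V).

Lemma nng0 : nng A 0.
Proof.
by have [//|] := nng_total (subgroup0 (dom_subgroup A)); rewrite oppr0.
Qed.

Lemma null_dom x : null A x -> dom A x. Proof. by case. Qed.

Lemma null_subgroup : subgroup (null A).
Proof.
have sgA := dom_subgroup A; split.
  by split; rewrite ?oppr0; [exact: subgroup0|exact: nng0|exact: nng0].
move=> x y [Ax px nx] [Ay py ny]; split; first subg.
  by apply: nngD => //; subg.
by rewrite opprB addrC; apply: nngD => //; subg.
Qed.

Lemma nng_null x y : dom A x -> null A (y - x) -> nng A x -> nng A y.
Proof.
move=> Ax [Ayx py ny] px; rewrite -(subrK x y).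
exact: nngD.
Qed.

Lemma nngMn x n : dom A x -> nng A x -> nng A (x *+ n).
Proof.
move=> Ax px; elim: n => [|n IH]; first exact: nng0.
have sgA := dom_subgroup A.
by rewrite mulrS; apply: nngD => //; subg.
Qed.

(** Totally ordered groups are torsion-free. *)
Lemma null_pure : pure (dom A) (null A).
Proof.
move=> x k Ax [Akx pk nk]; have sgA := dom_subgroup A.
have ANx : dom A (- x) by subg.
split=> //.
  have [//|nx] := nng_total Ax.
  have -> : x = x *+ k.+1 + (- x) *+ k by zlin.
  by apply: nngD => //; [subg|apply: nngMn].
have [px|//] := nng_total Ax.
have -> : - x = - (x *+ k.+1) + x *+ k by zlin.
by apply: nngD => //; [subg|subg|apply: nngMn].
Qed.

End Preordered.

Fixpoint teval (V : zmodType) (v : nat -> V) (t : oag_term) : V :=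
  match t with
  | OVar n => v n
  | OZero => 0
  | OAdd t1 t2 => teval v t1 + teval v t2
  | OOpp t1 => - teval v t1
  end.

(** Truth in the ordered group [dom A / null A], evaluated on representatives. *)
Fixpoint holds (V : zmodType) (A : preordered V) (v : nat -> V)
    (f : oag_formula) : Prop :=
  match f with
  | OEq t1 t2 => null A (teval v t1 - teval v t2)
  | OLt t1 t2 => ~ nng A (teval v t1 - teval v t2)
  | ONot f1 => ~ holds A v f1
  | OAnd f1 f2 => holds A v f1 /\ holds A v f2
  | OOr f1 f2 => holds A v f1 \/ holds A v f2
  | OImplies f1 f2 => holds A v f1 -> holds A v f2
  | OExists f1 => exists2 x, dom A x & holds A (scons x v) f1
  | OForall f1 => forall x, dom A x -> holds A (scons x v) f1
  end.

Definition assignment (V : zmodType) (A : preordered V) (v : nat -> V) : Prop :=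
  forall n, dom A (v n).

Lemma assignment_scons (V : zmodType) (A : preordered V) x v :
  dom A x -> assignment A v -> assignment A (scons x v).
Proof. by move=> Ax Av [|n] /=. Qed.

Lemma teval_subgroup (V : zmodType) (P : V -> Prop) (v : nat -> V) t :
  subgroup P -> (forall n, P (v n)) -> P (teval v t).
Proof.
move=> sgP Pv; elim: t => [n||t1 IH1 t2 IH2|t IH] //=; subg.
Qed.

Lemma teval_dom (V : zmodType) (A : preordered V) v t :
  assignment A v -> dom A (teval v t).
Proof. by move=> Av; apply: teval_subgroup => //; exact: dom_subgroup. Qed.

Lemma tevalD (V : zmodType) (v w : nat -> V) t :
  teval (fun n => v n + w n) t = teval v t + teval w t.
Proof.
elim: t => [n||t1 IH1 t2 IH2|t IH] //=; first by rewrite addr0.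
  by rewrite IH1 IH2; zlin.
by rewrite IH opprD.
Qed.

Lemma teval_scons (V : zmodType) t : exists (m : int) (t' : oag_term),
  forall (x : V) v, teval (scons x v) t = x *~ m + teval v t'.
Proof.
elim: t => [[|n]||t1 [m1 [u1 IH1]] t2 [m2 [u2 IH2]]|t [m [u IH]]] /=.
- by exists 1, OZero => x v /=; rewrite mulr1z addr0.
- by exists 0, (OVar n) => x v /=; rewrite mulr0z add0r.
- by exists 0, OZero => x v /=; rewrite mulr0z add0r.
- by exists (m1 + m2), (OAdd u1 u2) => x v /=; rewrite IH1 IH2; zlin.
- by exists (- m), (OOpp u) => x v /=; rewrite IH; zlin.
Qed.

Definition tmulz (m : int) (t : oag_term) : oag_term :=
  match m with
  | Posz n => iter n (OAdd t) OZero
  | Negz n => OOpp (iter n.+1 (OAdd t) OZero)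
  end.

Arguments tmulz : simpl never.

Lemma teval_mulz (V : zmodType) (v : nat -> V) m t :
  teval v (tmulz m t) = teval v t *~ m.
Proof.
have tevalMn n : teval v (iter n (OAdd t) OZero) = teval v t *+ n.
  by elim: n => //= n ->; rewrite mulrS.
case: m => n; first exact: tevalMn.
by rewrite NegzE mulrNz -[_ *~ _]/(_ *+ _) mulrS -tevalMn.
Qed.

Definition same_type (V W : zmodType) (A : preordered V) (v : nat -> V)
    (B : preordered W) (w : nat -> W) : Prop :=
  forall f, holds A v f <-> holds B w f.

Lemma same_type_sym (V W : zmodType) (A : preordered V) v (B : preordered W) w :
  same_type A v B w -> same_type B w A v.
Proof. by move=> AB f; split=> /AB. Qed.

Lemma same_type_trans (V W X : zmodType) (A : preordered V) v
    (B : preordered W) w (C : preordered X) x :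
  same_type A v B w -> same_type B w C x -> same_type A v C x.
Proof. by move=> AB BC f; split=> [/AB/BC|/BC/AB]. Qed.

(** * Back-and-forth systems *)

Section BackAndForth.

Variables (V W : zmodType) (A : preordered V) (B : preordered W).

Lemma same_type_nng v w t : same_type A v B w ->
  nng A (teval v t) <-> nng B (teval w t).
Proof.
move=> /(_ (OLt t OZero)) /=; rewrite !subr0 => -[AB BA].
by split=> p; apply: contrapT => np; [apply: BA|apply: AB].
Qed.

Lemma same_type_null v w t : same_type A v B w ->
  null A (teval v t) <-> null B (teval w t).
Proof. by move=> /(_ (OEq t OZero)) /=; rewrite !subr0. Qed.

Definition forth (R : (nat -> V) -> (nat -> W) -> Prop) : Prop :=
  forall v w x, R v w -> dom A x ->
    exists2 y, dom B y & R (scons x v) (scons y w).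

Definition back (R : (nat -> V) -> (nat -> W) -> Prop) : Prop :=
  forall v w y, R v w -> dom B y ->
    exists2 x, dom A x & R (scons x v) (scons y w).

(** Only [nng] has to be preserved on terms, since both kinds of atomic formulas are expressed by
    it. *)
Lemma back_and_forth (R : (nat -> V) -> (nat -> W) -> Prop) v w :
  (forall v w, R v w -> assignment A v /\ assignment B w) ->
  (forall v w t, R v w -> nng A (teval v t) <-> nng B (teval w t)) ->
  forth R -> back R -> R v w -> same_type A v B w.
Proof.
move=> RD Rnng Rforth Rback Rvw f.
elim: f v w Rvw => [t1 t2|t1 t2|f IH|f IHf g IHg|f IHf g IHg|f IHf g IHg
    |f IH|f IH] v w Rvw /=.
- have [Av Bw] := RD _ _ Rvw.
  have R1 := Rnng _ _ (OAdd t1 (OOpp t2)) Rvw.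
  have R2 := Rnng _ _ (OOpp (OAdd t1 (OOpp t2))) Rvw.
  split=> -[_ p n]; split; first [exact: (teval_dom (OAdd t1 (OOpp t2)))
    | exact/R1 | exact/R2].
- have R1 := Rnng _ _ (OAdd t1 (OOpp t2)) Rvw.
  by split=> n p; apply: n; apply/R1.
- by have := IH _ _ Rvw; tauto.
- by have := IHf _ _ Rvw; have := IHg _ _ Rvw; tauto.
- by have := IHf _ _ Rvw; have := IHg _ _ Rvw; tauto.
- by have := IHf _ _ Rvw; have := IHg _ _ Rvw; tauto.
- split=> [[x Ax]|[y By]].
    by have [y By Rxy] := Rforth _ _ _ Rvw Ax => /(IH _ _ Rxy); exists y.
  by have [x Ax Rxy] := Rback _ _ _ Rvw By => /(IH _ _ Rxy); exists x.
- split=> [fA y By|fB x Ax].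
    by have [x Ax Rxy] := Rback _ _ _ Rvw By; apply/(IH _ _ Rxy)/fA.
  by have [y By Rxy] := Rforth _ _ _ Rvw Ax; apply/(IH _ _ Rxy)/fB.
Qed.

(** Such an [R] induces an isomorphism between the ordered groups of classes. *)
Lemma same_type_correspondence (R : V * W -> Prop) v w :
  subgroup R -> (forall x y, R (x, y) -> dom A x /\ dom B y) ->
  (forall x y, R (x, y) -> nng A x <-> nng B y) ->
  (forall x, dom A x -> exists y, R (x, y)) ->
  (forall y, dom B y -> exists x, R (x, y)) ->
  (forall n, R (v n, w n)) -> same_type A v B w.
Proof.
move=> sgR RD Rnng RA RB Rvw.
apply: (@back_and_forth (fun v w => forall n, R (v n, w n))) => //.
- by move=> v' w' R'; split=> n; have [] := RD _ _ (R' n).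
- move=> v' w' t R'; apply: Rnng.
  suff -> : (teval v' t, teval w' t) = teval (fun n => (v' n, w' n)) t.
    exact: teval_subgroup.
  by elim: t => [n||t1 IH1 t2 IH2|t IH] //=; rewrite -?IH1 -?IH2 -?IH.
- move=> v' w' x R' /RA[y Rxy]; exists y; first by have [] := RD _ _ Rxy.
  by case.
- move=> v' w' y R' /RB[x Rxy]; exists x; first by have [] := RD _ _ Rxy.
  by case.
Qed.

End BackAndForth.

Lemma same_type_null_eq (V : zmodType) (A : preordered V) v w :
  assignment A v -> (forall n, null A (v n - w n)) -> same_type A v A w.
Proof.
move=> Av Nvw; have sgA := dom_subgroup A; have sgN := null_subgroup A.
apply: (@same_type_correspondence _ _ _ _
    (fun z => [/\ dom A z.1, dom A z.2 & null A (z.1 - z.2)])).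
- split=> /=; first by rewrite subrr; split; exact: subgroup0.
  move=> [x x'] [y y'] /= [Ax Ax' Nx] [Ay Ay' Ny]; split; [subg|subg|].
  have -> : x - y - (x' - y') = (x - x') - (y - y') by zlin.
  subg.
- by move=> x y /= [].
- move=> x y /= [Ax Ay Nxy]; split; apply: nng_null => //.
  by rewrite -opprB; subg.
- by move=> x Ax; exists x; rewrite subrr; split=> //; subg.
- by move=> x Ax; exists x; rewrite subrr; split=> //; subg.
move=> n /=; split=> //; rewrite -(subKr (v n) (w n)).
by have := null_dom (Nvw n); have := Av n => ? ?; subg.
Qed.

(** * Dependence of formulas on finitely many variables *)

Definition nvars_term : oag_term -> nat := fix loop t :=
  match t with
  | OVar n => n.+1
  | OZero => 0
  | OAdd t1 t2 => maxn (loop t1) (loop t2)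
  | OOpp t1 => loop t1
  end.

Fixpoint nvars (f : oag_formula) : nat :=
  match f with
  | OEq t1 t2 | OLt t1 t2 => maxn (nvars_term t1) (nvars_term t2)
  | ONot f1 => nvars f1
  | OAnd f1 f2 | OOr f1 f2 | OImplies f1 f2 => maxn (nvars f1) (nvars f2)
  | OExists f1 | OForall f1 => (nvars f1).-1
  end.

Lemma teval_nvars (V : zmodType) (v w : nat -> V) t :
  (forall n, (n < nvars_term t)%N -> v n = w n) -> teval v t = teval w t.
Proof.
elim: t => [n||t1 IH1 t2 IH2|t IH] //= vw; first exact: vw.
  by rewrite IH1 ?IH2 // => n ltn; apply: vw; rewrite leq_max ltn ?orbT.
by rewrite IH.
Qed.

Lemma holds_nvars (V : zmodType) (A : preordered V) (v w : nat -> V) f :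
  (forall n, (n < nvars f)%N -> v n = w n) -> holds A v f <-> holds A w f.
Proof.
elim: f v w => [t1 t2|t1 t2|f IH|f IHf g IHg|f IHf g IHg|f IHf g IHg
    |f IH|f IH] v w /= vw.
- rewrite (@teval_nvars _ v w t1) ?(@teval_nvars _ v w t2) // => n ltn;
    by apply: vw; rewrite leq_max ltn ?orbT.
- rewrite (@teval_nvars _ v w t1) ?(@teval_nvars _ v w t2) // => n ltn;
    by apply: vw; rewrite leq_max ltn ?orbT.
- by have := IH _ _ vw; tauto.
- have := IHf v w (fun n ltn => vw n (leq_trans ltn (leq_maxl _ _))).
  have := IHg v w (fun n ltn => vw n (leq_trans ltn (leq_maxr _ _))); tauto.
- have := IHf v w (fun n ltn => vw n (leq_trans ltn (leq_maxl _ _))).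
  have := IHg v w (fun n ltn => vw n (leq_trans ltn (leq_maxr _ _))); tauto.
- have := IHf v w (fun n ltn => vw n (leq_trans ltn (leq_maxl _ _))).
  have := IHg v w (fun n ltn => vw n (leq_trans ltn (leq_maxr _ _))); tauto.
- have IHx x : holds A (scons x v) f <-> holds A (scons x w) f.
    by apply: IH => -[|n] // ltn; apply: vw; rewrite /= -ltnS (ltn_predK ltn).
  by split=> -[x Ax /IHx]; exists x.
- have IHx x : holds A (scons x v) f <-> holds A (scons x w) f.
    by apply: IH => -[|n] // ltn; apply: vw; rewrite /= -ltnS (ltn_predK ltn).
  by split=> fA x /fA/IHx.
Qed.

(** * Ultraproducts *)

(** The encoding into trees serves to make terms and formulas countable, so that countable
    saturation realizes complete types. *)
Fixpoint term_encode (t : oag_term) : GenTree.tree nat :=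
  match t with
  | OVar n => GenTree.Leaf n
  | OZero => GenTree.Node 0 [::]
  | OAdd t1 t2 => GenTree.Node 1 [:: term_encode t1; term_encode t2]
  | OOpp t1 => GenTree.Node 2 [:: term_encode t1]
  end.

Fixpoint term_decode (t : GenTree.tree nat) : oag_term :=
  match t with
  | GenTree.Leaf n => OVar n
  | GenTree.Node 1 [:: t1; t2] => OAdd (term_decode t1) (term_decode t2)
  | GenTree.Node 2 [:: t1] => OOpp (term_decode t1)
  | _ => OZero
  end.

Lemma term_encodeK : cancel term_encode term_decode.
Proof. by elim=> //= [t1 -> t2 ->|t ->]. Qed.

Fixpoint formula_encode (f : oag_formula) : GenTree.tree nat :=
  match f with
  | OEq t1 t2 => GenTree.Node 0 [:: term_encode t1; term_encode t2]
  | OLt t1 t2 => GenTree.Node 1 [:: term_encode t1; term_encode t2]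
  | ONot f1 => GenTree.Node 2 [:: formula_encode f1]
  | OAnd f1 f2 => GenTree.Node 3 [:: formula_encode f1; formula_encode f2]
  | OOr f1 f2 => GenTree.Node 4 [:: formula_encode f1; formula_encode f2]
  | OImplies f1 f2 => GenTree.Node 5 [:: formula_encode f1; formula_encode f2]
  | OExists f1 => GenTree.Node 6 [:: formula_encode f1]
  | OForall f1 => GenTree.Node 7 [:: formula_encode f1]
  end.

Fixpoint formula_decode (t : GenTree.tree nat) : oag_formula :=
  match t with
  | GenTree.Node 0 [:: t1; t2] => OEq (term_decode t1) (term_decode t2)
  | GenTree.Node 1 [:: t1; t2] => OLt (term_decode t1) (term_decode t2)
  | GenTree.Node 2 [:: t1] => ONot (formula_decode t1)
  | GenTree.Node 3 [:: t1; t2] => OAnd (formula_decode t1) (formula_decode t2)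
  | GenTree.Node 4 [:: t1; t2] => OOr (formula_decode t1) (formula_decode t2)
  | GenTree.Node 5 [:: t1; t2] =>
      OImplies (formula_decode t1) (formula_decode t2)
  | GenTree.Node 6 [:: t1] => OExists (formula_decode t1)
  | GenTree.Node 7 [:: t1] => OForall (formula_decode t1)
  | _ => OEq OZero OZero
  end.

Lemma formula_encodeK : cancel formula_encode formula_decode.
Proof.
by elim=> //= [t1 t2|t1 t2|f ->|f -> g ->|f -> g ->|f -> g ->|f ->|f ->] //;
  rewrite !term_encodeK.
Qed.

HB.instance Definition _ := Countable.copy oag_term (can_type term_encodeK).
HB.instance Definition _ :=
  Countable.copy oag_formula (can_type formula_encodeK).

Lemma countable_enumeration (T : countType) (x0 : T) :
  exists e : nat -> T, forall x, exists j, e j = x.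
Proof.
exists (fun j => odflt x0 (unpickle j)) => x.
by exists (pickle x); rewrite pickleK.
Qed.

(** Countable, i.e. $\aleph_1$-, saturation: both the formulas and the parameters are indexed by
    [nat]. *)
Definition saturated (V : zmodType) (A : preordered V) : Prop :=
  forall (F : nat -> oag_formula) (v : nat -> V), assignment A v ->
    (forall n, exists2 x, dom A x &
       forall j, (j < n)%N -> holds A (scons x v) (F j)) ->
  exists2 x, dom A x & forall j, holds A (scons x v) (F j).


Fixpoint conjunction (F : nat -> oag_formula) (n : nat) : oag_formula :=
  if n is n'.+1 then OAnd (F n') (conjunction F n') else OEq OZero OZero.

Lemma holds_conjunction (V : zmodType) (A : preordered V) v F n :
  holds A v (conjunction F n) <-> forall j, (j < n)%N -> holds A v (F j).
Proof.
elim: n => [|n IH] /=.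
  by rewrite subrr; split=> // _; exact: subgroup0 (null_subgroup A).
split=> [[Fn /IH Fj] j|Fj].
  by rewrite ltnS leq_eqVlt => /predU1P[->|/Fj].
by split; [exact: Fj|apply/IH => j ltjn; exact/Fj/ltnW].
Qed.

Lemma saturated_realizes (V W : zmodType) (A : preordered V) (B : preordered W)
    v w x :
  saturated B -> assignment B w -> same_type A v B w -> dom A x ->
  exists2 y, dom B y & same_type A (scons x v) B (scons y w).
Proof.
move=> satB Bw AB Ax.
have [e e_surj] := countable_enumeration (OEq OZero OZero).
(* [F] enumerates the complete type of [x] over [v]. Its finite parts transfer to [w] as single
   existential formulas. *)
pose F j := if `[< holds A (scons x v) (e j) >] then e j else ONot (e j).
have AF j : holds A (scons x v) (F j) by rewrite /F; case: asboolP.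
have [|y By BF] := satB F w Bw.
  move=> n; have : holds A v (OExists (conjunction F n)).
    by exists x => //; apply/holds_conjunction.
  by move=> /AB[y By /holds_conjunction BF]; exists y.
exists y => // f; have [j <-] := e_surj f; have := BF j; have := AF j.
by rewrite /F; case: asboolP => /=; tauto.
Qed.

Lemma saturated_compact (V : zmodType) (A : preordered V) :
  saturated A -> algebraically_compact (dom A) (null A).
Proof.
move=> satA m k c Ac solv.
(* Variable 0 is the quotient [z], variable 1 the unknown [e], hence the shift by two for the
   parameter [c j]. *)
pose F j := OExists (OEq (OAdd (tmulz (m j) (OVar 1)) (OOpp (OVar j.+2)))
                         (tmulz (k j)%:Z (OVar 0))).
have FP j e : holds A (scons e c) (F j) <->
    solution (dom A) (null A) (m j) (k j) (c j) e.
  by rewrite /F /solution /=; split=> -[z Az Nz]; exists z => //;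
    move: Nz; rewrite !teval_mulz.
have [n|e Ae Fe] := satA F c Ac; last by exists e => // j; exact/FP.
by have [e Ae Se] := solv n; exists e => // j ltjn; apply/FP/Se.
Qed.

(** * Łoś's theorem and saturation of ultraproducts *)

Section Ultraproduct.

Variables (I : Type) (U : set_system I).
Hypothesis ultraU : UltraFilter U.

Lemma ultra_all (P : I -> Prop) : (forall i, P i) -> U P.
Proof. by move=> Pi; apply: filterS filterT. Qed.

Lemma ultra_imp (P Q : I -> Prop) : (forall i, P i -> Q i) -> U P -> U Q.
Proof. exact: filterS. Qed.

Lemma ultra_and (P Q : I -> Prop) : U (fun i => P i /\ Q i) <-> U P /\ U Q.
Proof.
split=> [UPQ|[]]; last exact: filterI.
by split; apply: ultra_imp UPQ => i [].
Qed.

Lemma ultra_iff (P Q : I -> Prop) : U (fun i => P i <-> Q i) -> U P <-> U Q.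
Proof.
by move=> UPQ; split=> UP; apply: filterS (filterI UPQ UP) => i [[]]; auto.
Qed.

Lemma ultra_not (P : I -> Prop) : U (fun i => ~ P i) <-> ~ U P.
Proof.
split=> [UnP UP|]; last by case: (in_ultra_setVsetC P ultraU).
have /filter_ex[i] : U (fun i => P i /\ ~ P i) by apply/ultra_and.
by case.
Qed.

Lemma ultra_or (P Q : I -> Prop) : U (fun i => P i \/ Q i) <-> U P \/ U Q.
Proof.
split=> [UPQ|[]]; last first.
- by apply: ultra_imp => i; right.
- by apply: ultra_imp => i; left.
have [UP|/ultra_not UnP] := pselect (U P); [by left|right].
by apply: filterS (filterI UPQ UnP) => i [[]].
Qed.

Lemma ultra_exists (X : Type) (x0 : I -> X) (P : I -> X -> Prop) :
  U (fun i => exists x, P i x) -> exists x : I -> X, U (fun i => P i (x i)).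
Proof.
have /choice[x xP] i : exists x, (exists y, P i y) -> P i x.
  by have [[y Py]|nP] := pselect (exists y, P i y); [exists y|exists (x0 i)].
by move=> UP; exists x; apply: ultra_imp UP.
Qed.

Variable V : zmodType.

Fact ultraproduct_subgroup (S : I -> preordered V) :
  subgroup (fun x : I -> V => U (fun i => dom (S i) (x i))).
Proof.
split=> [|x y Ux Uy].
  by apply: ultra_all => i; exact: subgroup0 (dom_subgroup _).
apply: filterS (filterI Ux Uy) => i [Sx Sy].
exact: subgroupB (dom_subgroup _) _ _ Sx Sy.
Qed.

Fact ultraproduct_total (S : I -> preordered V) (x : I -> V) :
  U (fun i => dom (S i) (x i)) ->
  U (fun i => nng (S i) (x i)) \/ U (fun i => nng (S i) ((- x) i)).
Proof. by move=> Ux; apply/ultra_or; apply: ultra_imp Ux => i /nng_total. Qed.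

Fact ultraproduct_nngD (S : I -> preordered V) (x y : I -> V) :
  U (fun i => dom (S i) (x i)) -> U (fun i => dom (S i) (y i)) ->
  U (fun i => nng (S i) (x i)) -> U (fun i => nng (S i) (y i)) ->
  U (fun i => nng (S i) ((x + y) i)).
Proof.
move=> Ux Uy px py.
apply: filterS (filterI (filterI Ux Uy) (filterI px py)) => i.
by case=> -[? ?] [? ?]; apply: nngD.
Qed.

Definition ultraproduct (S : I -> preordered V) : preordered (I -> V) :=
  Preordered (ultraproduct_subgroup S) (@ultraproduct_total S)
    (@ultraproduct_nngD S).

Lemma teval_ultraproduct (v : nat -> I -> V) t i :
  teval v t i = teval (fun n => v n i) t.
Proof.
by elim: t => [n||t1 IH1 t2 IH2|t IH] /=; rewrite -?IH1 -?IH2 -?IH.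
Qed.

Lemma scons_ultraproduct (x : I -> V) (v : nat -> I -> V) i :
  (fun n => scons x v n i) = scons (x i) (fun n => v n i).
Proof. by apply/funext; case. Qed.

Lemma null_ultraproduct (S : I -> preordered V) (x : I -> V) :
  null (ultraproduct S) x <-> U (fun i => null (S i) (x i)).
Proof.
split=> [[Sx px nx]|Ux].
  by apply: filterS (filterI Sx (filterI px nx)) => i [? []].
by split; apply: ultra_imp Ux => i [].
Qed.

(** Łoś's theorem. In the quantifier cases, witnesses or counterexamples are chosen
    coordinatewise. *)
Lemma los (S : I -> preordered V) (v : nat -> I -> V) f :
  holds (ultraproduct S) v f <-> U (fun i => holds (S i) (fun n => v n i) f).
Proof.
elim: f v => [t1 t2|t1 t2|f IH|f IHf g IHg|f IHf g IHg|f IHf g IHg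
    |f IH|f IH] v /=.
- rewrite null_ultraproduct; apply: ultra_iff; apply: ultra_all => i.
  by rewrite -(teval_ultraproduct v t1) -(teval_ultraproduct v t2).
- rewrite -ultra_not; apply: ultra_iff; apply: ultra_all => i.
  by rewrite -(teval_ultraproduct v t1) -(teval_ultraproduct v t2).
- by rewrite IH ultra_not.
- by rewrite IHf IHg ultra_and.
- by rewrite IHf IHg ultra_or.
- have -> : (fun i => holds (S i) (fun n => v n i) f ->
                      holds (S i) (fun n => v n i) g) =
            (fun i => ~ holds (S i) (fun n => v n i) f \/
                      holds (S i) (fun n => v n i) g).
    apply/funext => i; apply/propext.
    by have := EM (holds (S i) (v^~ i) f); tauto.
  rewrite ultra_or ultra_not -IHf -IHg.
  by have := EM (holds (ultraproduct S) v f); tauto.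
- split=> [[x Sx /IH]|Uf].
    move=> /(filterI Sx); apply: ultra_imp => i [Sxi].
    by rewrite scons_ultraproduct; exists (x i).
  have [|x Ux] := @ultra_exists V (fun=> 0)
      (fun i x => dom (S i) x /\ holds (S i) (scons x (v^~ i)) f).
    by apply: ultra_imp Uf => i [x Sx fx]; exists x.
  have [Sx fx] := (ultra_and _ _).1 Ux; exists x => //.
  by apply/IH; apply: ultra_imp fx => i; rewrite scons_ultraproduct.
- split=> [fx|Uf x Sx].
    apply: contrapT => /ultra_not Uf.
    have [|x Ux] := @ultra_exists V (fun=> 0)
        (fun i x => dom (S i) x /\ ~ holds (S i) (scons x (v^~ i)) f).
      apply: ultra_imp Uf => i nf; apply: contrapT => nx; apply: nf => x Sx.
      by apply: contrapT => nfx; apply: nx; exists x.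
    have [Sx /ultra_not] := (ultra_and _ _).1 Ux; apply.
    have /IH := fx x Sx; apply: ultra_imp => i.
    by rewrite scons_ultraproduct.
  apply/IH; apply: filterS (filterI Uf Sx) => i [fi Sxi].
  by rewrite scons_ultraproduct; apply: fi.
Qed.

Lemma same_type_ultrapower (A : preordered V) (v : nat -> V) :
  same_type A v (ultraproduct (fun=> A)) (fun n => cst (v n)).
Proof.
move=> f; rewrite los /=; split=> [Af|/filter_ex[i]//].
exact: ultra_all.
Qed.

(** The sets where [n <= rk i] form a descending chain in [U] with empty intersection. *)
Definition countably_incomplete : Prop :=
  exists rk : I -> nat, forall n, U (fun i => (n <= rk i)%N).

Lemma ultra_diagonal (X : Type) (x0 : I -> X) (Q : nat -> I -> X -> Prop) :
  countably_incomplete ->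
  (forall n, U (fun i => exists x, forall j, (j < n)%N -> Q j i x)) ->
  exists x : I -> X, forall j, U (fun i => Q j i (x i)).
Proof.
move=> [rk rkP] UQ.
(* At coordinate [i], [x] satisfies the longest satisfiable initial segment of conditions of length
   at most [rk i]. *)
have /choice[x xP] i : exists x, forall n, (n <= rk i)%N ->
    (exists y, forall j, (j < n)%N -> Q j i y) ->
    forall j, (j < n)%N -> Q j i x.
  elim: (rk i) => [|r [x IH]]; first by exists (x0 i) => -[].
  have [[y Qy]|nQ] := pselect (exists y, forall j, (j < r.+1)%N -> Q j i y).
    exists y => n lenr _ j ltjn; exact: Qy (leq_trans ltjn lenr).
  exists x => n; rewrite leq_eqVlt => /predU1P[->|]; [by []|exact: IH].
exists x => j; apply: filterS (filterI (rkP j.+1) (UQ j.+1)) => i [lerk Qi].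
exact: xP lerk Qi j (ltnSn j).
Qed.

Lemma ultraproduct_saturated (S : I -> preordered V) :
  countably_incomplete -> saturated (ultraproduct S).
Proof.
move=> ciU F v Sv solv.
have [n|x xP] := @ultra_diagonal V (fun=> 0)
  (fun j i x => dom (S i) x /\ holds (S i) (scons x (v^~ i)) (F j)) ciU.
  have [x Sx Fx] := solv n; have /los Ux : holds (ultraproduct S) (scons x v)
     (conjunction F n) by apply/holds_conjunction.
  apply: filterS (filterI Sx Ux) => i [Sxi].
  rewrite scons_ultraproduct => /holds_conjunction Fi; exists (x i) => j ltjn.
  by split=> //; apply: Fi.
exists x; first by have /ultra_and[] := xP 0%N.
move=> j; apply/los; have /ultra_and[_] := xP j.
by apply: ultra_imp => i; rewrite scons_ultraproduct.
Qed.

End Ultraproduct.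

(** * Types in extensions *)

(* [K] is a convex subgroup of [A] with quotient [E]. *)
Record convex_exact (V : zmodType) (K A E : preordered V) :
    Prop := ConvexExact {
  exact_dom : forall x, dom K x -> dom A x;
  exact_nng : forall x, dom K x -> nng K x <-> nng A x;
  exact_null : forall x, null A x -> dom K x;
  exact_domE : forall x, dom E x <-> dom A x;
  exact_nngE : forall x, dom A x -> nng E x <-> nng A x \/ dom K x
}.

Section ConvexExact.

Variables (V : zmodType) (K A E : preordered V).
Hypothesis KAE : convex_exact K A E.

Lemma exact_null_eq : null A = null K.
Proof.
have sgK := dom_subgroup K.
apply/funext => x; apply/propext; split=> [Nx|[Kx px nx]].
  have Kx := exact_null KAE Nx; have [_ px nx] := Nx.
  have KNx : dom K (- x) by subg.
  by split=> //; apply/(exact_nng KAE).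
have KNx : dom K (- x) by subg.
by split; [exact: exact_dom KAE _ Kx|apply/(exact_nng KAE)..].
Qed.

Lemma exact_nullE x : null E x <-> dom K x.
Proof.
have sgK := dom_subgroup K; have sgA := dom_subgroup A.
split=> [[/(exact_domE KAE) Ax px nx]|Kx].
  have ANx : dom A (- x) by subg.
  have [px'|//] := (exact_nngE KAE Ax).1 px.
  have [nx'|KNx] := (exact_nngE KAE ANx).1 nx.
    by apply: (exact_null KAE).
  by rewrite -[x]opprK; subg.
have Ax := exact_dom KAE Kx; have ANx : dom A (- x) by subg.
split; first exact/(exact_domE KAE).
  by apply/(exact_nngE KAE) => //; right.
by apply/(exact_nngE KAE) => //; right; subg.
Qed.

(** [dom K] consists of the null elements of [E], whose group of classes is torsion-free. *)
Lemma exact_pure : pure (dom A) (dom K).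
Proof.
by move=> x k /(exact_domE KAE) Ex /exact_nullE/(null_pure Ex)/exact_nullE.
Qed.

(** The order is lexicographic along a section: [a] decides the sign of [a + c] unless it lies in
    [K], where it is null and [c] decides. *)
Lemma exact_sign a c : dom A a -> dom K c -> (dom K a -> null A a) ->
  (dom K a -> nng A (a + c) <-> nng K c) /\
  (~ dom K a -> nng A (a + c) <-> nng E a).
Proof.
move=> Aa Kc Na; have Ac := exact_dom KAE Kc.
have sgA := dom_subgroup A; have sgN := null_subgroup A.
have sgK := dom_subgroup K; have sgNE := null_subgroup E.
have Aac : dom A (a + c) by subg.
split=> [/Na {}Na|nKa].
  rewrite (exact_nng KAE) //; split; apply: nng_null => //.
    have -> : c - (a + c) = - a by zlin.
    subg.
  by have -> : a + c - c = a by zlin.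
have Nc : null E c by apply/exact_nullE.
have Ea : dom E a by apply/(exact_domE KAE).
have Eac : dom E (a + c) by apply/(exact_domE KAE).
have -> : nng A (a + c) <-> nng E (a + c).
  rewrite (exact_nngE KAE) //; split; first by left.
  case=> // Kac; case: nKa.
  have -> : a = a + c - c by zlin.
  subg.
split; apply: nng_null => //.
  have -> : a - (a + c) = - c by zlin.
  subg.
by have -> : a + c - a = c by zlin.
Qed.

(** The subgroup generated by the values of [p], presented by terms because these can be
    enumerated. *)
Definition trange (p : nat -> V) (u : V) : Prop := exists t, u = teval p t.

Lemma trange_subgroup p : subgroup (trange p).
Proof.
split; first by exists OZero.
by move=> _ _ [t ->] [s ->]; exists (OAdd t (OOpp s)).
Qed.

Lemma section_step p x :
  saturated K -> assignment A p -> dom A x ->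
  pure_section (dom A) (dom K) (null A) (trange p) ->
  exists2 e, dom K e &
    pure_section (dom A) (dom K) (null A) (trange (scons (x - e) p)).
Proof.
move=> satK Ap Ax secp.
have [f fP] := countable_enumeration (OZero, 0 : int, 0%N).

have [|||e Ke eP] := section_extension (dom_subgroup A) (dom_subgroup K)
  (null_subgroup A) (trange_subgroup p) (exact_null KAE)
  (exact_dom KAE) _ exact_pure (@null_pure _ A) secp
  (f := fun j => (teval p (f j).1.1, (f j).1.2, (f j).2)) _ _ Ax.
- by move=> _ [t ->]; exact: teval_dom.
- move=> _ m k [t ->]; have [j fj] := fP (t, m, k).
  by exists j; rewrite fj.
- by rewrite exact_null_eq; exact: saturated_compact.
exists e => // _ k y [t ->] Ay; have [m [t' tE]] := teval_scons V t.
by rewrite tE; apply: eP => //; exists t'.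
Qed.

End ConvexExact.

(** * Gluing types along a convex subgroup *)

Lemma convex_exact_ultraproduct (I : Type) (U : set_system I)
    (ultraU : UltraFilter U) (V : zmodType) (K A E : I -> preordered V) :
  (forall i, convex_exact (K i) (A i) (E i)) ->
  convex_exact (ultraproduct ultraU K) (ultraproduct ultraU A)
    (ultraproduct ultraU E).
Proof.
move=> KAE; split=> x.
- by apply: ultra_imp => i; exact: exact_dom (KAE i) _.
- by move=> Kx; apply: ultra_iff; apply: ultra_imp Kx => i; exact: exact_nng.
- by move/null_ultraproduct; apply: ultra_imp => i; exact: exact_null (KAE i) _.
- by apply: ultra_iff; apply: ultra_all => i; exact: exact_domE.
- move=> Ax; rewrite -[_ \/ _]/(U _ \/ U _) -ultra_or; apply: ultra_iff.
  by apply: ultra_imp Ax => i; exact: exact_nngE.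
Qed.

(* A back-and-forth position: [v] and [w] are decomposed along sections [p] and
   [q] of the two quotient maps, and the components correspond to each other. *)
Definition glue_position (V W : zmodType) (K A E : preordered V)
    (M B F : preordered W) (v : nat -> V) (w : nat -> W) : Prop :=
  exists p c q d, [/\ v = (fun n => p n + c n), w = (fun n => q n + d n),
    assignment A p /\ assignment K c, assignment B q /\ assignment M d &
    [/\ same_type E p F q, same_type K c M d,
      pure_section (dom A) (dom K) (null A) (trange p) &
      pure_section (dom B) (dom M) (null B) (trange q)]].

Lemma glue_position_sym (V W : zmodType) (K A E : preordered V)
    (M B F : preordered W) v w :
  glue_position K A E M B F v w -> glue_position M B F K A E w v.
Proof.
move=> [p [c [q [d [vE wE Apc Bqd [Epq Kcd sp sq]]]]]].
by exists q, d, p, c; split=> //; split=> //; apply: same_type_sym.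
Qed.

(** Split [x] into [x - e], which prolongs the section, and [e] in [K]. Their types are realized
    independently in [F] and in [M], and the representative found for [F] is corrected by an element
    of [M] to prolong the other section. *)
Lemma glue_forth (V W : zmodType) (K A E : preordered V)
    (M B F : preordered W) :
  convex_exact K A E -> convex_exact M B F ->
  saturated K -> saturated M -> saturated F ->
  forth A B (glue_position K A E M B F).
Proof.
move=> KAE MBF satK satM satF v w x
  [p [c [q [d [-> -> [Ap Kc] [Bq Md] [Epq Kcd sp sq]]]]]] Ax.
have sgA := dom_subgroup A; have sgB := dom_subgroup B.
have [e Ke spx] := section_step KAE satK Ap Ax sp.
have Ae := exact_dom KAE Ke.
have Exe : dom E (x - e) by apply/(exact_domE KAE); subg.
have Fq : assignment F q by move=> n; apply/(exact_domE MBF).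
have [y Fy Exy] := saturated_realizes satF Fq Epq Exe.
have By : dom B y by apply/(exact_domE MBF).
have [b Mb sqy] := section_step MBF satM Bq By sq.
have Bb := exact_dom MBF Mb.
have [z Mz Kez] := saturated_realizes satM Md Kcd Ke.
have Bz := exact_dom MBF Mz.
exists (y - b + z); first subg.
exists (scons (x - e) p), (scons e c), (scons (y - b) q), (scons z d); split.
- by apply/funext => -[|n] //=; rewrite subrK.
- by apply/funext => -[|n].
- by split; apply: assignment_scons => //; subg.
- by split; apply: assignment_scons => //; subg.
(* Subtracting [b], an element of [M], does not change the class of [y] in [F]. *)
split=> //; apply: same_type_trans Exy _; apply: same_type_null_eq.
  exact: assignment_scons.
have sgN := null_subgroup F.
case=> [|n] /=; last by rewrite subrr; exact: subgroup0.
by rewrite subKr; apply/(exact_nullE MBF).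
Qed.

(** The hypothesis on the zero assignments says that the quotients [E] and [F] are elementarily
    equivalent. *)
Lemma glue_saturated (V W : zmodType) (K A E : preordered V)
    (M B F : preordered W) v w :
  convex_exact K A E -> convex_exact M B F ->
  saturated K -> saturated E -> saturated M -> saturated F ->
  assignment K v -> assignment M w -> same_type K v M w ->
  same_type E (fun=> 0) F (fun=> 0) -> same_type A v B w.
Proof.
move=> KAE MBF satK satE satM satF Kv Mw KM EF.
apply: (@back_and_forth _ _ _ _ (glue_position K A E M B F)).
- move=> {Kv Mw KM} {}v {}w.
  move=> [p [c [q [d [-> -> [Ap Kc] [Bq Md] _]]]]].
  have sgA := dom_subgroup A; have sgB := dom_subgroup B.
  split=> n; apply: subgroupD => //.
    exact: exact_dom KAE _ (Kc n).
  exact: exact_dom MBF _ (Md n).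
- move=> {Kv Mw KM} {}v {}w t.
  move=> [p [c [q [d [-> -> [Ap Kc] [Bq Md] [Epq Kcd sp sq]]]]]].
  rewrite !tevalD.
  (* The case [k = 0] of [pure_section]: the section meets [K] only in null elements, as
     [exact_sign] needs. *)
  have Np : dom K (teval p t) -> null A (teval p t).
    move=> Kp; have [|||y _] := sp (teval p t) 0%N 0.
    - by exists t.
    - exact: subgroup0 (dom_subgroup A).
    - by rewrite mulr0n subr0.
    by rewrite mulr0n subr0.
  have Nq : dom M (teval q t) -> null B (teval q t).
    move=> Mq; have [|||y _] := sq (teval q t) 0%N 0.
    - by exists t.
    - exact: subgroup0 (dom_subgroup B).
    - by rewrite mulr0n subr0.
    by rewrite mulr0n subr0.
  have [Kpc nKpc] := exact_sign KAE (teval_dom t Ap) (teval_dom t Kc) Np.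
  have [Mqd nMqd] := exact_sign MBF (teval_dom t Bq) (teval_dom t Md) Nq.
  have KM : dom K (teval p t) <-> dom M (teval q t).
    by rewrite -(exact_nullE KAE) -(exact_nullE MBF); exact: same_type_null.
  have [Kp|nKp] := pselect (dom K (teval p t)).
    have Mq := KM.1 Kp; rewrite (Kpc Kp) (Mqd Mq); exact: same_type_nng.
  have nMq : ~ dom M (teval q t) by move=> /KM.
  rewrite (nKpc nKp) (nMqd nMq); exact: same_type_nng.
- exact: glue_forth.
- move=> {Kv Mw KM} {}v {}w y /glue_position_sym Rwv By.
  have [x Ax Ryx] := glue_forth MBF KAE satM satK satE Rwv By.
  by exists x => //; apply: glue_position_sym.
(* The given tuples lie in [K] and [M], so the game starts from the zero section. *)
have sec0 (X : zmodType) (C D : preordered X) :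
    pure_section (dom C) (dom D) (null C) (trange (fun=> 0)).
  move=> u k y [t ->] _ _; exists 0; first exact: subgroup0 (dom_subgroup C).
  have -> : teval (fun=> 0) t = 0 :> X.
    elim: t => //= [t -> s ->|t ->]; by rewrite ?addr0 ?oppr0.
  by rewrite mul0rn subrr; exact: subgroup0 (null_subgroup C).
exists (fun=> 0), v, (fun=> 0), w; split.
- by apply/funext => n; rewrite add0r.
- by apply/funext => n; rewrite add0r.
- by split=> // n; exact: subgroup0 (dom_subgroup A).
- by split=> // n; exact: subgroup0 (dom_subgroup B).
by split.
Qed.

Lemma ultrafilter_on_nat :
  exists U : set_system nat, UltraFilter U /\ forall n, U (fun i => (n <= i)%N).
Proof.
have [U [ultraU Uev]] := ultraFilterLemma eventually_filter.
by exists U; split=> // n; apply: Uev; exists n.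
Qed.

(* Passing to ultrapowers of the two exact sequences makes everything
   saturated. *)
Lemma same_type_extension (V W : zmodType) (K A E : preordered V)
    (M B F : preordered W) v w :
  convex_exact K A E -> convex_exact M B F ->
  assignment K v -> assignment M w -> same_type K v M w ->
  same_type E (fun=> 0) F (fun=> 0) -> same_type A v B w.
Proof.
move=> KAE MBF Kv Mw KM EF.
have [U [ultraU Uge]] := ultrafilter_on_nat.
have ciU : countably_incomplete U by exists id.
have upE (X Y : zmodType) (C : preordered X) (D : preordered Y) x y :
    same_type C x D y <->
    same_type (ultraproduct ultraU (fun=> C)) (fun n => cst (x n))
      (ultraproduct ultraU (fun=> D)) (fun n => cst (y n)).
  have Cx := same_type_ultrapower ultraU C x.
  have Dy := same_type_ultrapower ultraU D y.
  split=> CD.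
    exact: same_type_trans (same_type_sym Cx) (same_type_trans CD Dy).
  exact: same_type_trans Cx (same_type_trans CD (same_type_sym Dy)).
apply/upE; apply: (@glue_saturated _ _
  (ultraproduct ultraU (fun=> K)) _ (ultraproduct ultraU (fun=> E))
  (ultraproduct ultraU (fun=> M)) _ (ultraproduct ultraU (fun=> F)));
  do ?[exact: convex_exact_ultraproduct | exact: ultraproduct_saturated].
- by move=> n; apply: (ultra_all ultraU) => i; exact: Kv.
- by move=> n; apply: (ultra_all ultraU) => i; exact: Mw.
- exact: (upE _ _ _ _ _ _).1 KM.
- exact: (upE _ _ _ _ (fun=> 0) (fun=> 0)).1 EF.
Qed.

(** * Quotients and convex subgroups *)

Definition full (V : zmodType) (A : preordered V) : Prop := forall x, dom A x.

Definition null_pred (V : zmodType) (A : preordered V) : {pred V} :=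
  fun x => `[< null A x >].

Fact null_pred_zmod_closed (V : zmodType) (A : preordered V) :
  zmod_closed (null_pred A).
Proof.
have [N0 NB] := null_subgroup A.
by split=> [|x y /asboolP Nx /asboolP Ny]; apply/asboolP => //; apply: NB.
Qed.

HB.instance Definition _ (V : zmodType) (A : preordered V) :=
  GRing.isZmodClosed.Build V (null_pred A) (null_pred_zmod_closed A).

(** The type carries the proof [fullA] so that the order instance, whose axioms rest on it, can be
    attached. *)
Definition collapse (V : zmodType) (A : preordered V) (fullA : full A) : Type :=
  {ideal_quot null_pred A}.

Section Collapse.

Variables (V : zmodType) (A : preordered V) (fullA : full A).

HB.instance Definition _ := GRing.Zmodule.on (collapse fullA).

Definition collapse_pi (x : V) : collapse fullA :=
  (\pi_{ideal_quot null_pred A} x)%qT.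

Lemma collapse_piB x y : collapse_pi (x - y) = collapse_pi x - collapse_pi y.
Proof. by rewrite /collapse_pi raddfB. Qed.

Lemma collapse_piD x y : collapse_pi (x + y) = collapse_pi x + collapse_pi y.
Proof. by rewrite /collapse_pi raddfD. Qed.

Lemma collapse_eq x y : collapse_pi x = collapse_pi y <-> null A (x - y).
Proof.
rewrite /collapse_pi; split=> [/eqP|Nxy].
  by rewrite -Quotient.idealrBE => /asboolP.
by apply/eqP; rewrite -Quotient.idealrBE; apply/asboolP.
Qed.

Lemma collapse_piP (x : collapse fullA) : exists y, x = collapse_pi y.
Proof.
by exists (repr (x : {ideal_quot null_pred A})); rewrite /collapse_pi reprK.
Qed.

Definition collapse_le (x y : collapse fullA) : bool :=
  `[< exists a b, [/\ x = collapse_pi a, y = collapse_pi b & nng A (b - a)] >].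

Lemma collapse_leE x y :
  collapse_le (collapse_pi x) (collapse_pi y) <-> nng A (y - x).
Proof.
split=> [/asboolP[a [b [/collapse_eq xa /collapse_eq yb ab]]]|xy]; last first.
  by apply/asboolP; exists x, y.
have sgN := null_subgroup A.
apply: nng_null ab; first exact: fullA.
have -> : y - x - (b - a) = (y - b) - (x - a) by zlin.
subg.
Qed.

Fact collapse_le_refl : reflexive collapse_le.
Proof.
by move=> x; have [a ->] := collapse_piP x; apply/collapse_leE; rewrite subrr;
  apply: nng0.
Qed.

Fact collapse_le_anti : antisymmetric collapse_le.
Proof.
move=> x y; have [a ->] := collapse_piP x; have [b ->] := collapse_piP y.
case/andP => /collapse_leE ab /collapse_leE ba.
by apply/collapse_eq; split; rewrite ?opprB.
Qed.

Fact collapse_le_trans : transitive collapse_le.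
Proof.
move=> y x z; have [a ->] := collapse_piP x; have [b ->] := collapse_piP y.
have [c ->] := collapse_piP z => /collapse_leE ab /collapse_leE bc.
apply/collapse_leE; have -> : c - a = (b - a) + (c - b) by zlin.
exact: nngD.
Qed.

HB.instance Definition _ := Order.Le_isPOrder.Build ring_display
  (collapse fullA) collapse_le_refl collapse_le_anti collapse_le_trans.

Fact collapse_total : total (<=%R : rel (collapse fullA)).
Proof.
move=> x y; have [a ->] := collapse_piP x; have [b ->] := collapse_piP y.
have [ab|ba] := nng_total (fullA (b - a)); apply/orP; [left|right].
  exact/collapse_leE.
by apply/collapse_leE; rewrite -opprB.
Qed.

Fact collapse_lerD2 (z x y : collapse fullA) : x <= y -> z + x <= z + y.
Proof.
have [a ->] := collapse_piP x; have [b ->] := collapse_piP y.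
have [c ->] := collapse_piP z => /collapse_leE ab.
rewrite -!collapse_piD; apply/collapse_leE.
by have -> : c + b - (c + a) = b - a by zlin.
Qed.

Definition collapse_group : orderedAbGroup :=
  @OrderedAbGroup (collapse fullA) collapse_total collapse_lerD2.

End Collapse.

(** * Ordered groups as preordered groups *)

Fact of_group_subgroup (G : orderedAbGroup) :
  subgroup (fun _ : G => True).
Proof. by []. Qed.

Fact of_group_total (G : orderedAbGroup) (x : G) :
  True -> 0 <= x \/ 0 <= - x.
Proof.
move=> _; have /orP[x0|] := oag_total 0 x; [by left|right].
by have := oag_lerD2 (- x) b; rewrite addNr addr0.
Qed.

Fact of_group_nngD (G : orderedAbGroup) (x y : G) :
  True -> True -> 0 <= x -> 0 <= y -> 0 <= x + y.
Proof.
move=> _ _ x0 y0; apply: le_trans x0 _.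
by have := oag_lerD2 x y0; rewrite addr0.
Qed.

Definition of_group (G : orderedAbGroup) : preordered G :=
  Preordered (@of_group_subgroup G) (@of_group_total G) (@of_group_nngD G).

Lemma of_group_leE (G : orderedAbGroup) (x y : G) : (x <= y) = (0 <= y - x).
Proof.
apply/idP/idP => [xy|yx].
  by have := oag_lerD2 (- x) xy; rewrite addNr addrC.
by have := oag_lerD2 x yx; rewrite addr0 addrC subrK.
Qed.

Lemma of_group_nullE (G : orderedAbGroup) (x : G) :
  null (of_group G) x <-> x = 0.
Proof.
split=> [[_ /= x0 nx0]|->]; last exact: subgroup0 (null_subgroup _).
by apply: le_anti; rewrite x0 of_group_leE sub0r nx0.
Qed.

Lemma oag_evalE (G : orderedAbGroup) (v : nat -> G) t :
  oag_eval v t = teval v t.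
Proof. by elim: t => //= [t1 -> t2 ->|t ->]. Qed.

Lemma oag_holdsE (G : orderedAbGroup) (v : nat -> G) f :
  oag_holds v f <-> holds (of_group G) v f.
Proof.
elim: f v => [t1 t2|t1 t2|f IH|f IHf g IHg|f IHf g IHg|f IHf g IHg
    |f IH|f IH] v /=; rewrite ?oag_evalE.
- rewrite of_group_nullE; split=> [->|/eqP]; first by rewrite subrr.
  by rewrite subr_eq0 => /eqP.
- rewrite -of_group_leE lt_neqAle.
  have /orP[] := oag_total (teval v t1) (teval v t2).
    move=> le12; rewrite le12 andbT; split=> [/eqP n12 le21|n21].
      by apply: n12; apply: le_anti; rewrite le12.
    by apply/eqP => e12; apply: n21; rewrite e12.
  by move=> le21; split=> [/andP[/eqP n12 le12]|//]; case: n12; apply: le_anti;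
    rewrite le12.
- by have := IH v; tauto.
- by have := IHf v; have := IHg v; tauto.
- by have := IHf v; have := IHg v; tauto.
- by have := IHf v; have := IHg v; tauto.
- by split=> [[x /IH]|[x _ /IH]]; exists x.
- by split=> [fx x _|fx x]; apply/IH => //; apply: fx.
Qed.

(** * Convex subgroups and their quotients *)

Record convex (V : zmodType) (A : preordered V) (C : V -> Prop) :
    Prop := Convex {
  convex_subgroup : subgroup C;
  convex_dom : forall x, C x -> dom A x;
  convex_between : forall x y, dom A x -> nng A x -> nng A (y - x) -> C y -> C x
}.

Lemma convex_null (V : zmodType) (A : preordered V) C x :
  convex A C -> null A x -> C x.
Proof.
move=> convC [Ax px nx]; apply: (convex_between convC Ax px (y := 0)).
  by rewrite sub0r.
exact: subgroup0 (convex_subgroup convC).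
Qed.

Section Convex.

Variables (V : zmodType) (A : preordered V) (C : V -> Prop).
Hypothesis convC : convex A C.

Fact convex_sub_total x : C x -> nng A x \/ nng A (- x).
Proof. by move=> /(convex_dom convC)/nng_total. Qed.

Fact convex_sub_nngD x y :
  C x -> C y -> nng A x -> nng A y -> nng A (x + y).
Proof.
by move=> /(convex_dom convC) Ax /(convex_dom convC) Ay; apply: nngD.
Qed.

Definition convex_sub : preordered V :=
  Preordered (convex_subgroup convC) convex_sub_total convex_sub_nngD.

Fact convex_quo_total x :
  dom A x -> (nng A x \/ C x) \/ (nng A (- x) \/ C (- x)).
Proof. by move=> /nng_total[]; [left|right]; left. Qed.

Fact convex_quo_nngD x y : dom A x -> dom A y ->
  nng A x \/ C x -> nng A y \/ C y -> nng A (x + y) \/ C (x + y).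
Proof.
have sgC := convex_subgroup convC; have sgA := dom_subgroup A.
(* If [u + v] is not nonnegative, then [u] lies between 0 and [- v], hence in [C] by convexity. *)
suff half u v : dom A u -> nng A u -> C v -> nng A (u + v) \/ C (u + v).
  move=> Ax Ay [px|Cx] [py|Cy].
  - by left; apply: nngD.
  - exact: half.
  - by rewrite addrC; apply: half.
  by right; subg.
move=> Au pu Cv; have Av := convex_dom convC Cv.
have Auv : dom A (u + v) by subg.
have [|nuv] := nng_total Auv; [by left|right].
have Cu : C u; last by subg.
apply: (convex_between convC Au pu (y := - v)); last by subg.
by have -> : - v - u = - (u + v) by zlin.
Qed.

Definition convex_quo : preordered V :=
  @Preordered V (dom A) (fun x => nng A x \/ C x) (dom_subgroup A)
    convex_quo_total convex_quo_nngD.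

Lemma convex_exactP : convex_exact convex_sub A convex_quo.
Proof. by split=> //= x; [apply: convex_dom | apply: convex_null]. Qed.

End Convex.

Lemma convex_subsub (V : zmodType) (A : preordered V) (C D : V -> Prop)
    (convC : convex A C) (convD : convex A D) :
  (forall x, C x -> D x) -> convex (convex_sub convD) C.
Proof.
move=> CD; split=> //=; first exact: convex_subgroup convC.
by move=> x y /(convex_dom convD); exact: convex_between convC _ _.
Qed.

Lemma convex_exact_subsub (V : zmodType) (A : preordered V) (C D : V -> Prop)
    (convC : convex A C) (convD : convex A D) (CD : forall x, C x -> D x) :
  convex_exact (convex_sub convC) (convex_sub convD)
    (convex_quo (convex_subsub convC convD CD)).
Proof.
by split=> //= x; exact: convex_null (convex_subsub convC convD CD).
Qed.

(** * End extensions *)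

(* The convex subgroup generated by [a] if [a] is nonnegative, and that of the
   null elements otherwise. *)
Definition principal_hull (V : zmodType) (A : preordered V) (a x : V) : Prop :=
  exists n, nng A (a *+ n - x) /\ nng A (a *+ n + x).

Section PrincipalHull.

Variables (V : zmodType) (A : preordered V).
Hypothesis fullA : full A.

Lemma principal_hull_convex a : convex A (principal_hull A a).
Proof.
split=> [|x _|x y _ px pyx [n [pn nn]]]; [|exact: fullA|].
  split; first by exists 0%N; rewrite mulr0n subr0 addr0; split; exact: nng0.
  move=> x y [n [pn nn]] [m [pm nm]]; exists (n + m)%N; split.
    have -> : a *+ (n + m) - (x - y) = (a *+ n - x) + (a *+ m + y) by zlin.
    exact: nngD.
  have -> : a *+ (n + m) + (x - y) = (a *+ n + x) + (a *+ m - y) by zlin.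
  exact: nngD.
exists n; split.
  have -> : a *+ n - x = (a *+ n - y) + (y - x) by zlin.
  exact: nngD.
have -> : a *+ n + x = (a *+ n - y) + (y - x) + x *+ 2 by zlin.
by do ![apply: nngD => //]; apply: nngMn.
Qed.

Lemma principal_hull_mem x : exists a, principal_hull A a x.
Proof.
have [px|nx] := nng_total (fullA x).
  exists x, 1%N; rewrite mulr1n subrr; split; first exact: nng0.
  exact: nngD.
exists (- x), 1%N; rewrite mulr1n addNr; split; last exact: nng0.
exact: nngD.
Qed.

Lemma principal_hull_ub a b : exists c, forall x,
  principal_hull A a x \/ principal_hull A b x -> principal_hull A c x.
Proof.
have mono c d y : nng A (d - c) -> principal_hull A c y -> principal_hull A d y.
  move=> pdc [n [pn nn]]; exists n; split.
    have -> : d *+ n - y = (d - c) *+ n + (c *+ n - y) by zlin.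
    by apply: nngD => //; apply: nngMn.
  have -> : d *+ n + y = (d - c) *+ n + (c *+ n + y) by zlin.
  by apply: nngD => //; apply: nngMn.
have [pba|pab] := nng_total (fullA (b - a)).
  by exists b => x [|//]; apply: mono.
by exists a => x [//|]; apply: mono; rewrite -opprB.
Qed.

End PrincipalHull.

(** The directed family of principal convex subgroups has no largest member. *)
Definition no_top (V : zmodType) (A : preordered V) : Prop :=
  forall a, exists x, ~ principal_hull A a x.

Lemma ultrapower_no_top (U : set_system nat) (ultraU : UltraFilter U)
    (G : orderedAbGroup) :
  (forall n, U (fun i => (n <= i)%N)) -> nontrivial G ->
  no_top (ultraproduct ultraU (fun=> of_group G)).
Proof.
move=> Uge [u0 u0_neq0] a.
have [u u_ge0 u_neq0] : exists2 u : G, 0 <= u & u <> 0.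
  have [u0_ge0|nu0] := @nng_total _ (of_group G) u0 I.
    by exists u0 => //; apply/eqP.
  by exists (- u0) => //; apply/eqP; rewrite oppr_eq0.
(* The sequence [a i *+ i] eventually dominates each fixed multiple of [a]; adding the positive [u]
   makes the excess strict, also where [a i] is negative. *)
exists (fun i => (if 0 <= a i then a i *+ i else 0) + u) => -[n [Un _]].
have [i [/= ain leni]] := filter_ex (filterI Un (Uge n)).
apply: u_neq0; apply/of_group_nullE; split=> //=.
have natmulE k : (a *+ k) i = a i *+ k.
  by elim: k => // k IH; rewrite !mulrS -IH.
have {ain} : 0 <= a i *+ n - ((if 0 <= a i then a i *+ i else 0) + u).
  by rewrite -natmulE.
case: ifPn => [ai_ge0|ai_lt0] ain.
  have -> : - u = (a i *+ n - (a i *+ i + u)) + a i *+ (i - n)%N.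
    by rewrite mulrnBr //; zlin.
  by apply: of_group_nngD => //; apply: (@nngMn _ (of_group G)).
have Nai_ge0 : 0 <= - a i.
  by have [pai|//] := @nng_total _ (of_group G) (a i) I; rewrite pai in ai_lt0.
have -> : - u = (a i *+ n - (0 + u)) + (- a i) *+ n by zlin.
by apply: of_group_nngD => //; apply: (@nngMn _ (of_group G)).
Qed.

Section EndExtension.

Variables (V0 : zmodType) (G0 : preordered V0).
Hypotheses (fullG0 : full G0) (G0_no_top : no_top G0).
Variables (U : set_system nat) (ultraU : UltraFilter U).
Hypothesis Uge : forall n, U (fun i => (n <= i)%N).

Let V1 : zmodType := nat -> V0.
Let G1 : preordered V1 := ultraproduct ultraU (fun=> G0).

Let hull_conv a := principal_hull_convex fullG0 a.

(** Hulls are taken coordinatewise so that [K a] is an ultraproduct, hence saturated. *)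
Let K (a : V1) : preordered V1 :=
  ultraproduct ultraU (fun i => convex_sub (hull_conv (a i))).

(** Inclusion is imposed at every coordinate, so that each factor of [E] is a genuine quotient. *)
Let le (a b : V1) : Prop :=
  forall i x, principal_hull G0 (a i) x -> principal_hull G0 (b i) x.

Let E a b (ab : le a b) : preordered V1 := ultraproduct ultraU
  (fun i => convex_quo
     (convex_subsub (hull_conv (a i)) (hull_conv (b i)) (ab i))).

Let K_exact a b (ab : le a b) : convex_exact (K a) (K b) (E ab).
Proof.
by apply: convex_exact_ultraproduct => i; exact: convex_exact_subsub.
Qed.

Let K_le a b x : le a b -> dom (K a) x -> dom (K b) x.
Proof. by move=> ab; apply: ultra_imp => i; apply: ab. Qed.

Let le_trans a b c : le a b -> le b c -> le a c.
Proof. by move=> ab bc i x /ab/bc. Qed.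

Let le_ub a b : exists2 c, le a c & le b c.
Proof.
have /choice[c cP] i := principal_hull_ub fullG0 (a i) (b i).
by exists c => i x ?; apply: cP; [left|right].
Qed.

Let le_mem a x : exists2 b, le a b & dom (K b) x.
Proof.
have /choice[c cP] i := principal_hull_mem fullG0 (x i).
have Kcx : dom (K c) x by apply: ultra_all.
by have [b ab cb] := le_ub a c; exists b => //; apply: K_le Kcx.
Qed.

Let ciU : countably_incomplete U. Proof. by exists id. Qed.

Let J : Type := (nat * V1)%type.

(** The cones of the directed order on [J] generate a proper filter. The first component gives
    countable incompleteness, the second makes [C] proper. *)
Lemma ultrafilter_on_pairs : exists W : set_system J,
  UltraFilter W /\ forall n a, W (fun i => (n <= i.1)%N /\ le a i.2).
Proof.
pose base (i : J) : J -> Prop := fun j => (i.1 <= j.1)%N /\ le i.2 j.2.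
have base_filter : ProperFilter (filter_from setT base).
  apply: filter_from_proper; last by move=> i _; exists i; split.
  apply: filter_fromT_filter; first by exists (0%N, 0 : V1).
  move=> [n a] [m b]; have [c ac bc] := le_ub a b.
  exists (maxn n m, c) => -[k d] [/=]; rewrite geq_max => /andP[nk mk] cd.
  by split; split=> //=; apply: le_trans cd.
have [W [ultraW Wbase]] := ultraFilterLemma base_filter.
by exists W; split=> // n a; apply: Wbase; exists (n, a).
Qed.

Variables (W : set_system J) (ultraW : UltraFilter W).
Hypothesis Wge : forall n a, W (fun i => (n <= i.1)%N /\ le a i.2).

Let ciW : countably_incomplete W.
Proof.
exists fst => n; have := Wge n 0.
by apply: (ultra_imp ultraW) => i [].
Qed.

Let V2 : zmodType := J -> V1.
Let G2 : preordered V2 := ultraproduct ultraW (fun=> G1).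
Let K2 (a : V1) : preordered V2 := ultraproduct ultraW (fun=> K a).

Let K2_le a b x : le a b -> dom (K2 a) x -> dom (K2 b) x.
Proof. by move=> ab; apply: ultra_imp => i; exact: K_le. Qed.

Let C (x : V2) : Prop := exists a, dom (K2 a) x.

Let C_convex : convex G2 C.
Proof.
split=> [|x [a]|x y Gx px pxy [a Ky]].
- split; first by exists 0; exact: subgroup0 (dom_subgroup _).
  move=> x y [a Kx] [b Ky]; have [c ac bc] := le_ub a b; exists c.
  apply: (subgroupB (dom_subgroup (K2 c))); [exact: K2_le Kx|exact: K2_le Ky].
- by apply: ultra_imp => i; apply: ultra_imp => j _; exact: fullG0.
exists a; apply: (filterS _ (filterI Ky (filterI px pxy))) => i [Kyi [pxi pxyi]].
apply: (filterS _ (filterI Kyi (filterI pxi pxyi))) => j [Kyj [pxj pxyj]].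
exact: (convex_between (hull_conv (a j)) (fullG0 (x i j)) pxj (y := y i j)).
Qed.

(** The quotient of [K2 b] by [K2 a] is the ultrapower of that of [K b] by [K a], so both have the
    same theory. *)
Let glue_up a b v w : le a b ->
  assignment (K a) v -> assignment (K2 a) w ->
  same_type (K a) v (K2 a) w -> same_type (K b) v (K2 b) w.
Proof.
move=> ab Kv Kw Kvw.
apply: (same_type_extension (F := ultraproduct ultraW (fun=> E ab))
  (K_exact ab) _ Kv Kw Kvw).
  by apply: convex_exact_ultraproduct => i; exact: K_exact ab.
exact: (same_type_ultrapower ultraW (E ab) (fun=> 0)).
Qed.

Lemma same_type_end_extension (v : nat -> V1) a :
  (forall n, dom (K a) (v n)) ->
  same_type G1 v (convex_sub C_convex) (fun n => cst (v n)).
Proof.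
move=> Kv.
pose R (v : nat -> V1) (w : nat -> V2) := exists a,
  [/\ assignment (K a) v, assignment (K2 a) w & same_type (K a) v (K2 a) w].
apply: (@back_and_forth _ _ _ _ R).
- move=> {a Kv} {}v w [a [Kv Kw _]]; split=> n; last by exists a; exact: Kw.
  by apply: ultra_all => i; exact: fullG0.
- move=> {a Kv} {}v w t [a [_ _ Kvw]]; exact: (same_type_nng t Kvw).
- move=> {a Kv} {}v w x [a [Kv Kw Kvw]] _.
  (* Pass to a stage containing [x]; [glue_up] keeps the types equal there, and saturation of [K2 b]
     supplies the partner. *)
  have [b ab Kbx] := le_mem a x.
  have Kbw : assignment (K2 b) w by move=> n; exact: K2_le (Kw n).
  have sat2 : saturated (K2 b) by exact: ultraproduct_saturated.
  have [y Kby Kxy] := saturated_realizes sat2 Kbw (glue_up ab Kv Kw Kvw) Kbx.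
  exists y; first by exists b.
  exists b; split=> //; apply: assignment_scons => //.
  by move=> n; exact: K_le (Kv n).
- move=> {a Kv} {}v w y [a [Kv Kw Kvw]] [a' Ky].
  have [b ab a'b] := le_ub a a'.
  have Kbv : assignment (K b) v by move=> n; exact: K_le (Kv n).
  have sat1 : saturated (K b) by exact: ultraproduct_saturated.
  have [x Kbx Kyx] := saturated_realizes sat1 Kbv
    (same_type_sym (glue_up ab Kv Kw Kvw)) (K2_le a'b Ky).
  exists x; first by apply: ultra_all => i; exact: fullG0.
  exists b; split; [exact: assignment_scons| |exact: same_type_sym].
  by apply: assignment_scons; [exact: K2_le Ky|move=> n; exact: K2_le (Kw n)].
exists a; split=> //; last exact: same_type_ultrapower.
by move=> n; apply: ultra_all => i; exact: Kv.
Qed.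

(** By directedness finitely many elements lie in one stage [K a]. *)
Let finite_support_bounded (v : nat -> V1) N :
  (forall n, (N <= n)%N -> v n = 0) -> exists a, forall n, dom (K a) (v n).
Proof.
move=> vN; suff [a aP] : exists a, forall n, (n < N)%N -> dom (K a) (v n).
  exists a => n; have [/aP//|/vN ->] := ltnP n N.
  exact: subgroup0 (dom_subgroup _).
elim: {vN} N => [|N [a aP]]; first by exists 0.
have [b ab Kb] := le_mem a (v N); exists b => n.
by rewrite ltnS leq_eqVlt => /predU1P[->//|/aP]; apply: K_le.
Qed.

Let C_proper : exists z, ~ C z.
Proof.
have /choice[g gP] := G0_no_top.
(* At the index [(n, b)] this takes values outside the hulls of [b]. For almost all indices [b] is
   above [a], so it lies in no [K2 a]. *)
exists (fun j i => g (j.2 i)) => -[a Kz].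
have [[n b] [Kb [_ ab]]] := filter_ex (filterI Kz (Wge 0 a)).
have [i Ki] := filter_ex Kb.
exact: gP (b i) (ab i _ Ki).
Qed.

Lemma end_extension_over_pairs : exists (V : zmodType) (A : preordered V)
    (D : V -> Prop) (convD : convex A D) (d : V0 -> V),
  [/\ full A, exists z, ~ D z & forall (v : nat -> V0) N,
    (forall n, (N <= n)%N -> v n = 0) ->
    [/\ forall n, D (d (v n)), same_type G0 v A (d \o v) &
        same_type G0 v (convex_sub convD) (d \o v)]].
Proof.
exists V2, G2, C, C_convex, (fun x => cst (cst x)); split=> //.
  by move=> x; apply: ultra_all => j; apply: ultra_all => i; exact: fullG0.
move=> v N vN.
have [|a Kv] := @finite_support_bounded (fun n => cst (v n)) N.
  by move=> n /vN ->.
have G01 := same_type_ultrapower ultraU G0 v.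
split.
- by move=> n; exists a; apply: ultra_all => j; exact: Kv.
- by apply: same_type_trans G01 _; exact: same_type_ultrapower.
- by apply: same_type_trans G01 _; exact: same_type_end_extension Kv.
Qed.

End EndExtension.

Lemma end_extension (V0 : zmodType) (G0 : preordered V0) :
  full G0 -> no_top G0 -> exists (V : zmodType) (A : preordered V)
    (D : V -> Prop) (convD : convex A D) (d : V0 -> V),
  [/\ full A, exists z, ~ D z & forall (v : nat -> V0) N,
    (forall n, (N <= n)%N -> v n = 0) ->
    [/\ forall n, D (d (v n)), same_type G0 v A (d \o v) &
        same_type G0 v (convex_sub convD) (d \o v)]].
Proof.
move=> fullG0 topG0; have [U [ultraU Uge]] := ultrafilter_on_nat.
have [W [ultraW Wge]] := ultrafilter_on_pairs fullG0.
exact: (end_extension_over_pairs fullG0 topG0 ultraU Uge ultraW Wge).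
Qed.

(** * The lexicographic sum as an extension of [H] by [G] *)

Section LexSum.

Variables (H G : orderedAbGroup).

Let B := of_group (lexsum H G).

Lemma lexsum_ge0 (z : lexsum H G) :
  (0 <= z) = (0 <= z.1) && ((z.1 <= 0) ==> (0 <= z.2)).
Proof. by case: z => h g; rewrite Order.ProdLexiOrder.leEprodlexi. Qed.

Fact lexsum_inr_convex : convex B (fun z => z.1 = 0).
Proof.
split=> // [|x y _ /= x_ge0 yx_ge0 y1].
  by split=> // x y /= -> ->; rewrite subr0.
move: x_ge0; rewrite lexsum_ge0 => /andP[x1_ge0 _].
move: yx_ge0; rewrite lexsum_ge0 => /andP[]; rewrite /= y1 sub0r => x1_le0 _.
by apply: le_anti; rewrite x1_ge0 andbT of_group_leE sub0r.
Qed.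

Lemma same_type_lexsum_inr (v : nat -> G) :
  same_type (of_group G) v (convex_sub lexsum_inr_convex)
    (@lexsum_inr H G \o v).
Proof.
apply: (@same_type_correspondence _ _ _ _
  (fun z : G * lexsum H G => z.2 = lexsum_inr H z.1)) => //.
- split=> // -[x x'] [y y'] /= -> ->.
  by rewrite /lexsum_inr; congr pair; rewrite subr0.
- by move=> x y /= ->.
- by move=> x y /= ->; rewrite lexsum_ge0 /= lexx.
- by move=> x _; exists (lexsum_inr H x).
- by move=> [h g] /= ->; exists g.
Qed.

(** Both preordered groups have [H] as ordered group of classes: one through [p], the other through
    the first projection. *)
Lemma same_type_lexsum_quo (V : zmodType) (A : preordered V) (p : V -> H) :
  full A -> {morph p : x y / x - y} -> (forall h, exists x, h = p x) ->
  (forall x, nng A x <-> 0 <= p x) ->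
  same_type A (fun=> 0) (convex_quo lexsum_inr_convex) (fun=> 0).
Proof.
move=> fullA pB p_surj pnng.
have p0 : p 0 = 0 by rewrite -(subrr 0) pB subrr.
apply: (@same_type_correspondence _ _ _ _
  (fun z : V * lexsum H G => z.2.1 = p z.1)) => //.
- by split=> // -[x x'] [y y'] /= -> ->; rewrite pB.
- move=> x y /= yx; rewrite pnng lexsum_ge0 -yx; split=> [y_ge0|].
    have [y1|y1] := pselect (y.1 = 0); [by right|left].
    rewrite y_ge0; apply/implyP => y1_le0; case: y1.
    by apply: le_anti; rewrite y1_le0.
  by case=> [/andP[]//|->].
- by move=> x _; exists (p x, 0).
- by move=> y _; exact: p_surj.
Qed.

End LexSum.

Theorem theorem4p3 (G : orderedAbGroup) (ntG : nontrivial G) :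
  augmentable_by_infinites G.
Proof.
have [U [ultraU Uge]] := ultrafilter_on_nat.
have topG0 := ultrapower_no_top ultraU Uge ntG.
set G0 := ultraproduct _ _ in topG0.
have fullG0 : full G0 by move=> x; apply: ultra_all.
have [V [A [D [convD [d [fullA [z nDz] dP]]]]]] := end_extension fullG0 topG0.
have fullE : full (convex_quo convD) by exact: fullA.
pose p := collapse_pi fullE.
have p0 : p 0 = 0 by rewrite /p -[in LHS](subrr 0) collapse_piB subrr.
(* The augment is [A / D], non-trivial because [z] lies outside [D]. *)
exists (collapse_group fullE); split.
  exists (p z); apply/eqP => pz0; apply: nDz.
  have /collapse_eq : p z = p 0 by rewrite pz0 p0.
  by rewrite subr0 => /(exact_nullE (convex_exactP convD)).
(* The end extension handles finitely supported assignments only, so the variables that [f] cannot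
   mention are set to 0. *)
move=> f v; pose v' n := if (n < nvars f)%N then v n else 0.
have holdsE (L : orderedAbGroup) (w w' : nat -> L) :
    (forall n, (n < nvars f)%N -> w n = w' n) ->
    oag_holds w f <-> holds (of_group L) w' f.
  by move=> ww'; rewrite oag_holdsE; exact: holds_nvars.
have vv' n : (n < nvars f)%N -> v n = v' n by rewrite /v' => ->.
rewrite (holdsE _ v v') //.
rewrite (holdsE _ _ (@lexsum_inr (collapse_group fullE) G \o v')); last first.
  by move=> n /vv' /= ->.
have G0v' := same_type_ultrapower ultraU (of_group G) v'.
have [|Dv' G0A G0D] := dP (fun n => cst (v' n)) (nvars f).
  by move=> n; rewrite /v' ltnNge => ->.
have GA := same_type_trans G0v' G0A.
have GD := same_type_trans G0v' G0D.
suff : same_type (of_group G) v' (of_group (lexsum (collapse_group fullE) G))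
  (@lexsum_inr (collapse_group fullE) G \o v') by apply.
(* It remains to compare [A] with the lexicographic sum: the tuples have the same type in the convex
   subgroups [D] and [G], and both quotients have the theory of the augment. *)
apply: same_type_trans GA _.
apply: (same_type_extension (convex_exactP convD)
  (convex_exactP (lexsum_inr_convex (collapse_group fullE) G)) Dv') => //.
  exact: same_type_trans (same_type_sym GD) (same_type_lexsum_inr _ _).
apply: (@same_type_lexsum_quo (collapse_group fullE) G _ _ p) => //.
- exact: collapse_piB.
- exact: collapse_piP.
move=> x; rewrite -p0 -[in nng _ x](subr0 x).
by split=> [px|/collapse_leE//]; apply/collapse_leE.
Qed.
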